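(* Given a Banach space $X$, $X$ is reflexive (resp., has a separable dual) if and only if $X^{\mathbb{N}}$ is reflexive (resp., has a separable dual). In particular, the sets $$\mathrm{REFL}_{\neg\mathrm{B}}=\{X\in\mathrm{SF}\mid X\text{ is reflexive and not normable}\}\quad\text{and}\quad\mathrm{SD}_{\neg\mathrm{B}}=\{X\in\mathrm{SF}\mid X\text{ has a separable dual and is not normable}\}$$ are not Borel.
   Context: A Fréchet space is a completely metrizable locally convex topological vector space (real scalars) whose topology can be defined by an invariant metric. $X^{\mathbb{N}}$ is the countable power of $X$ with the product topology; it is a Fréchet space. The dual of a Fréchet space is its topological dual with the strong topology (uniform convergence on bounded sets). Reflexivity is the usual notion for locally convex spaces: the canonical map into the strong bidual is an isomorphism onto. $C(\mathbb{R})$ is the Fréchet space of continuous real-valued functions on $\mathbb{R}$ with the topology of uniform convergence on compact sets. $\mathrm{SF}=\{X\subseteq C(\mathbb{R})\mid X\text{ is a closed vector subspace}\}$ with the Effros Borel structure, i.e., the $\sigma$-algebra generated by the sets $\{X\in\mathrm{SF}\mid X\cap U\neq\emptyset\}$, $U\subseteq C(\mathbb{R})$ open; it is a standard Borel space. $X\in\mathrm{SF}$ is normable if there is a norm on $X$ generating its topology. *)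

(* Defs.v *)
From HB Require Import structures.
From mathcomp Require Import all_boot all_order all_algebra.
From mathcomp Require Import all_classical all_reals all_analysis.

Set Implicit Arguments.
Unset Strict Implicit.
Unset Printing Implicit Defensive.

Import Order.TTheory GRing.Theory Num.Theory.
Import numFieldNormedType.Exports.

Local Open Scope classical_set_scope.
Local Open Scope ring_scope.

(** The notions below are stated for a [preTopologicalLmodType R], a vector
    space carrying a topology.  They do not mention the compatibility of the two
    structures, and at this level of generality they can be iterated (as in the
    dual of a dual) without carrying proofs. *)

Record lsubspace (R : realType) (E : lmodType R) := LSubspace {
  lsubspace_set :> set E ;
  lsubspace_closed : submod_closed [in lsubspace_set] }.

Definition lsubspace_pred (R : realType) (E : lmodType R) (A : lsubspace E) :
  {pred E} := [in lsubspace_set A].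

HB.instance Definition _ (R : realType) (E : lmodType R) (A : lsubspace E) :=
  GRing.isSubmodClosed.Build R E (lsubspace_pred A) (lsubspace_closed A).

(** A linear subspace as a space in its own right; it is convertible to
    [set_type A], whose library topology is the induced one. *)
Definition space_of (R : realType) (E : preTopologicalLmodType R)
  (A : lsubspace E) : Type := {x : E | x \in lsubspace_pred A}.

HB.instance Definition _ (R : realType) (E : preTopologicalLmodType R)
  (A : lsubspace E) := SubChoice.on (space_of A).
HB.instance Definition _ (R : realType) (E : preTopologicalLmodType R)
  (A : lsubspace E) := [SubChoice_isSubLmodule of space_of A by <:].
HB.instance Definition _ (R : realType) (E : preTopologicalLmodType R)
  (A : lsubspace E) := Topological.copy (space_of A) (set_type A).

Definition countable_power (R : realType) (E : preTopologicalLmodType R) :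
  Type := {ptws nat -> E}.

HB.instance Definition _ (R : realType) (E : preTopologicalLmodType R) :=
  Topological.copy (countable_power E) {ptws nat -> E}.
HB.instance Definition _ (R : realType) (E : preTopologicalLmodType R) :=
  GRing.Lmodule.copy (countable_power E) (nat -> E).

(** The space of all functions [U -> R] with pointwise operations, topologized
    by uniform convergence on the members of [fam].  It is only an ambient space
    for the dual of a space and for [C(R)]; scaling need not be continuous. *)
HB.instance Definition _ (R : realType) (U : choiceType) (fam : set U -> Prop) :=
  GRing.Lmodule.copy {family fam, U -> R^o} (U -> R^o).

Section strong_dual.
Variables (R : realType) (E : preTopologicalLmodType R).

(** Boundedness in the sense of von Neumann: every neighbourhood of [0] absorbs
    [A]. *)
Definition tvs_bounded (A : set E) : Prop :=
  forall U : set E, nbhs 0 U ->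
    \forall t \near +oo%R, A `<=` [set (t : R) *: u | u in U].

Definition continuous_functionals : set {family tvs_bounded, E -> R^o} :=
  [set f | linear (f : E -> R^o) /\ continuous (f : E -> R^o)].

Lemma continuous_functionals_closed : submod_closed [in continuous_functionals].
Proof.
split=> [|a f g].
  rewrite inE; split=> [b x y|x]; first by rewrite /= scaler0 addr0.
  exact: (@cst_continuous E R^o 0 x).
rewrite !inE => -[lf cf] [lg cg]; split=> [b x y|x].
  have -> z : (a *: f + g) z = a *: f z + g z :> R^o by [].
  by rewrite lf lg !scalerDr !scalerA [a * b]mulrC addrACA.
apply: (@continuousD R R^o E (fun z => a *: f z) (g : E -> R^o)).
  by apply: continuousZl_tmp; exact: cf.
exact: cg.
Qed.

Definition strong_dual : Type :=
  space_of (LSubspace continuous_functionals_closed).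

HB.instance Definition _ := PreTopologicalLmodule.on strong_dual.

Definition dual_fun (f : strong_dual) : E -> R := proj1_sig f.

Definition has_separable_dual : Prop :=
  exists2 D : set strong_dual, countable D & dense D.

Definition normable : Prop :=
  exists N : E -> R,
    [/\ forall x y, N (x + y) <= N x + N y,
        forall a x, N (a *: x) = `|a| * N x,
        forall x, N x = 0 -> x = 0 &
        forall (x : E) (A : set E), nbhs x A <->
          exists2 e : R, 0 < e & [set y | N (y - x) < e] `<=` A].

End strong_dual.

Coercion dual_fun : strong_dual >-> Funclass.

(** The first condition determines [J]: it is the evaluation map from [E] to its
    strong bidual (in particular [J] is linear). *)
Definition is_reflexive (R : realType) (E : preTopologicalLmodType R) : Prop :=
  exists (J : E -> strong_dual (strong_dual E))
         (K : strong_dual (strong_dual E) -> E),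
    [/\ forall x (f : strong_dual E), J x f = f x,
        cancel J K, cancel K J, continuous J & continuous K].

Section spaces_of_continuous_functions.
Variable R : realType.

Definition continuous_functions : set {family compact, R -> R^o} :=
  [set f | continuous (f : R -> R^o)].

Lemma continuous_functions_closed : submod_closed [in continuous_functions].
Proof.
split=> [|a f g]; first by rewrite inE => x; exact: (@cst_continuous R R^o 0 x).
rewrite !inE => cf cg x.
apply: (@continuousD R R^o R (fun z => a *: f z) (g : R -> R^o)).
  by apply: continuousZl_tmp; exact: cf.
exact: cg.
Qed.

Definition CR : Type := space_of (LSubspace continuous_functions_closed).

HB.instance Definition _ := PreTopologicalLmodule.on CR.

Record SF := MkSF { SF_subspace :> lsubspace CR ;
                    SF_closed : closed (SF_subspace : set CR) }.

(** The Effros Borel structure on [SF]. *)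
Definition SF_borel : set_system SF :=
  <<s [set [set X : SF | (X : set CR) `&` U !=set0] | U in @open CR] >>.

Definition REFL_notB : set SF :=
  [set X : SF | is_reflexive (space_of X) /\ ~ normable (space_of X)].

Definition SD_notB : set SF :=
  [set X : SF | has_separable_dual (space_of X) /\ ~ normable (space_of X)].

End spaces_of_continuous_functions.

Arguments REFL_notB : clear implicits.
Arguments SD_notB : clear implicits.

(* Main.v *)
Require Import Defs.
From mathcomp Require Import all_boot all_order all_algebra.
From mathcomp Require Import all_classical all_reals all_analysis.
From mathcomp Require Import ring lra.

Set Implicit Arguments.
Unset Strict Implicit.
Unset Printing Implicit Defensive.

Import Order.TTheory GRing.Theory Num.Theory.
Import numFieldNormedType.Exports.

Local Open Scope classical_set_scope.
Local Open Scope ring_scope.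

(** The two parts of the statement have independent proofs.

    For a Banach space [X] and its power, [X] is a continuous linear retract of
    the power, and both properties pass to retracts.  In the other direction, a
    continuous functional on the power depends on finitely many coordinates
    ([power_dual_finite]), so the dual is the direct sum of copies of the dual of
    [X].  This gives a countable dense set at once, and it shows that an element
    of the bidual is determined by its restrictions to the factors, which
    reflexivity of [X] turns into the coordinates of a point.  Continuity of the
    evaluation map into the strong bidual holds for any space whose topology is
    given by a sequence of seminorms ([continuous_evaluation]).

    For the non-Borel sets, a closed subspace of the space of continuous functions
    is attached to every tree [A] of finite sequences of integers, in such a way
    that if [A] has no branch then the subspace is reflexive with separable dual,
    and if [A] has a branch then it is not reflexive and its dual is not
    separable.  The subspace is the closed span of functions [basis s], for [s] in
    [A], each the product of a positive weight and of a function with values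
    between minus one and one; the latter realize all sign patterns simultaneously
    between any two consecutive natural numbers.  Hence the sup norms on segments
    are equivalent to weighted l1 norms of the coefficients
    ([basis_combination_le], [le_basis_combination]) and the subspace is a Köthe
    echelon space.  The weights are chosen so that an infinite set of indices on
    which weights of different levels are comparable has bounded entries at each
    place.  By König's lemma ([koenig]) such a set, inside the tree, produces a
    branch.

    If the tree has no branch, it follows that the tails of the expansions are
    uniformly small on bounded sets ([uniform_tail]), as in a Fréchet-Montel space.
    Functionals are then approximated by finite combinations of coefficients, so
    the dual is separable, and every element of the bidual is the evaluation at a
    sum of basis vectors ([evaluation_surjective]).  If the tree has a branch, the
    basis vectors along it are bounded and behave like the unit vectors of l1:
    evaluations realize uncountably many separated functionals on them
    ([koethe_not_separable_dual]), and their limit along an ultrafilter is an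
    element of the bidual that is not represented ([koethe_not_reflexive]).  The
    trees considered contain all the sequences of length one, which prevents the
    subspace from being normable ([koethe_not_normable]).

    A subspace attached to a tree meets a given open set when finitely many
    indices from a countable list of possibilities belong to the tree.  So if one
    of the two sets were Borel, a set of codes of well-founded trees would be
    analytic, which a diagonal argument excludes
    ([koethe_dichotomy_not_borel]). *)

(** * Neighbourhoods for uniform convergence on a directed family *)

Section uniform_convergence.
Variables (R : realType) (U : choiceType) (fam : set U -> Prop).
Hypothesis fam0 : fam set0.
Hypothesis famU : forall A B, fam A -> fam B -> fam (A `|` B).

(** Each member of the family induces a uniform topology and the family
    topology is their supremum.  As finitely many members lie in a single one,
    a member and a radius are enough to describe a neighbourhood. *)
Lemma family_nbhsP (f : {family fam, U -> R^o}) (W : set {family fam, U -> R^o}) :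
  nbhs f W <-> exists B, fam B /\ exists2 e : R, 0 < e &
    forall g : U -> R^o, (forall x, B x -> `|g x - f x| < e) -> W g.
Proof.
split; last first.
  case=> B [famB [e e0 BW]].
  have nB : nbhs f [set g : U -> R^o | forall x, B x -> ball (f x : R^o) e (g x)].
    apply: (@fam_nbhs U R^o fam B [set xy | ball xy.1 e xy.2] f _ famB).
    exact: (@entourage_ball R R^o (PosNum e0)).
  apply: filterS nB => g gB; apply: BW => x /gB.
  by rewrite -ball_normE /= distrC.
pose F : set_system (U -> R^o) :=
  filter_from [set Be : set U * R | fam Be.1 /\ 0 < Be.2]
   (fun Be => [set g | forall x, Be.1 x -> `|g x - f x| < Be.2]).
have FF : Filter F.
  apply: filter_from_filter; first by exists (set0, 1); split => //=.
  move=> [A a] [B b] [/= fA a0] [/= fB b0].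
  exists (A `|` B, Num.min a b) => /=.
    by split; [exact: famU | rewrite lt_min a0].
  move=> g gAB; split => x xA; have := gAB x; rewrite lt_min.
    by case/(_ (or_introl xA))/andP.
  by case/(_ (or_intror xA))/andP.
have /fam_cvgP Ff : forall A, fam A -> {uniform A, F --> (f : U -> R^o)}.
  move=> A fA P /uniform_nbhs[E [entE EP]].
  move: entE; rewrite -entourage_ballE => -[e /= e0 eE].
  exists (A, e) => //= g gA; apply: EP => x /gA fg; apply: eE => /=.
  by rewrite -ball_normE /= distrC.
by move=> /Ff[[B e] [/= fB e0] BW]; exists B; split=> //; exists e.
Qed.

End uniform_convergence.

Lemma space_of_nbhsP (R : realType) (E : preTopologicalLmodType R)
  (A : lsubspace E) (x : space_of A) (W : set (space_of A)) :
  nbhs x W <-> exists2 V : set E, nbhs (proj1_sig x) V &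
    forall y : space_of A, V (proj1_sig y) -> W y.
Proof.
split=> [[_ /= [[V oV <-] /= Vx VW]]|[V nV VW]].
  by exists V => //; exact: open_nbhs_nbhs.
have := @initial_continuous (set_type A) E set_val x V nV.
exact: (@filterS (set_type A) (nbhs (x : set_type A))).
Qed.

Section subspace_values.
Variables (R : realType) (E : preTopologicalLmodType R) (A : lsubspace E).
Implicit Types x z : space_of A.

Lemma val_comb (a : R) x z : val (a *: x + z) = a *: val x + val z.
Proof. by []. Qed.

Lemma val_sub x z : val (x - z) = val x - val z.
Proof. by []. Qed.

Lemma val_scale (a : R) x : val (a *: x) = a *: val x.
Proof. by []. Qed.

Lemma val_sum (I : Type) (r : seq I) (f : I -> space_of A) :
  val (\sum_(i <- r) f i) = \sum_(i <- r) val (f i).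
Proof. by elim/big_rec2: _ => // i u v _ <-. Qed.

End subspace_values.

(** * Strong duals and biduals *)

Section functionals.
Variables (R : realType) (E : preTopologicalLmodType R).
Implicit Types (f g : strong_dual E) (x y : E).

Lemma dual_linear f : linear (f : E -> R^o).
Proof. by case: f => f fP; have := fP; rewrite inE => -[]. Qed.

Lemma dual_continuous f : continuous (f : E -> R^o).
Proof. by case: f => f fP; have := fP; rewrite inE => -[]. Qed.

Lemma dual_eqP f g : (forall x, f x = g x) -> f = g.
Proof. by move=> fg; apply: val_inj; apply/funext. Qed.

Lemma dual_combE f x y a : f (a *: x + y) = a * f x + f y.
Proof. exact: dual_linear. Qed.

Lemma dual0 f : f 0 = 0.
Proof. by have := dual_combE f 0 0 (-1); rewrite scaler0 addr0 mulN1r addNr. Qed.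

Lemma dualD f x y : f (x + y) = f x + f y.
Proof. by rewrite -[x in LHS]scale1r dual_combE mul1r. Qed.

Lemma dualZ f a x : f (a *: x) = a * f x.
Proof. by rewrite -[a *: x]addr0 dual_combE dual0 addr0. Qed.

Lemma dualB f x y : f (x - y) = f x - f y.
Proof. by rewrite dualD -scaleN1r dualZ mulN1r. Qed.

Lemma dual_sum f (I : Type) (s : seq I) (F : I -> E) :
  f (\sum_(i <- s) F i) = \sum_(i <- s) f (F i).
Proof. by elim/big_rec2: _ => [|i y z _ <-]; rewrite ?dual0// dualD. Qed.

Lemma scale_dualE a f x : (a *: f : strong_dual E) x = a * f x. Proof. by []. Qed.
Lemma zero_dualE x : (0 : strong_dual E) x = 0. Proof. by []. Qed.

Lemma sub_dualE f g x : (f - g : strong_dual E) x = f x - g x.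
Proof. by []. Qed.

Lemma sum_dualE (I : Type) (s : seq I) (F : I -> strong_dual E) x :
  (\sum_(i <- s) F i : strong_dual E) x = \sum_(i <- s) F i x.
Proof. by elim/big_rec2: _ => // i y z _ <-. Qed.

Lemma mem_continuous_functionals (f : E -> R) :
  linear (f : E -> R^o) -> continuous (f : E -> R^o) ->
  (f : {family @tvs_bounded R E, E -> R^o})
    \in lsubspace_pred (LSubspace (@continuous_functionals_closed R E)).
Proof. by move=> lf cf; rewrite inE. Qed.

Definition mk_dual (f : E -> R) (lf : linear (f : E -> R^o))
    (cf : continuous (f : E -> R^o)) : strong_dual E :=
  exist _ f (mem_continuous_functionals lf cf).

Lemma bounded_set0 : tvs_bounded (@set0 E).
Proof. by move=> U _; apply: nearW => t x. Qed.

Lemma bounded_setU (A B : set E) :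
  tvs_bounded A -> tvs_bounded B -> tvs_bounded (A `|` B).
Proof.
move=> bA bB U nU; near=> t => x [|].
  by move: x; near: t; exact: bA.
by move: x; near: t; exact: bB.
Unshelve. all: by end_near. Qed.

(** Finite unions of bounded sets are bounded, so that one bounded set
    is enough. *)
Lemma dual_nbhsP f (W : set (strong_dual E)) :
  nbhs f W <-> exists B, tvs_bounded B /\ exists2 e : R, 0 < e &
    forall g, (forall x, B x -> `|g x - f x| < e) -> W g.
Proof.
split.
  move=> /space_of_nbhsP[V].
  move=> /(family_nbhsP bounded_set0 bounded_setU)[B [bB [e e0 BV]]] VW.
  by exists B; split=> //; exists e => // g gB; apply: VW; exact: BV.
case=> B [bB [e e0 BW]]; apply/space_of_nbhsP.
exists [set h | forall x, B x -> `|h x - f x| < e]; last exact: BW.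
apply/(family_nbhsP bounded_set0 bounded_setU).
by exists B; split => //; exists e.
Qed.

Lemma bounded_absorb (A : set E) (U : set E) : tvs_bounded A -> nbhs 0 U ->
  exists2 t : R, 0 < t & A `<=` [set t *: u | u in U].
Proof.
move=> bA nU; near +oo_R => t; exists t; first by near: t; exact: nbhs_pinfty_gt.
by near: t; exact: bA.
Unshelve. all: by end_near. Qed.

Lemma dual_nbhs0 f (e : R) : 0 < e -> nbhs 0 [set x | `|f x| < e].
Proof.
move=> e0.
have fe : nbhs 0 [set x | ball (f 0 : R^o) e (f x)].
  by apply: dual_continuous; exact: (nbhsx_ballx (f 0 : R^o)).
by apply: filterS fe => x; rewrite /= -ball_normE /= dual0 sub0r normrN.
Qed.

Lemma dual_bounded_on f (B : set E) : tvs_bounded B ->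
  exists M : R, forall x, B x -> `|f x| <= M.
Proof.
move=> bB; have nU := dual_nbhs0 f ltr01.
have [t t0 Bt] := bounded_absorb bB nU; exists t => x /Bt[u /= u1 <-].
by rewrite dualZ normrM gtr0_norm// ler_piMr// ltW.
Qed.

Lemma nbhs_dual0 (B : set E) (e : R) : tvs_bounded B -> 0 < e ->
  nbhs (0 : strong_dual E) [set f | forall x, B x -> `|f x| < e].
Proof.
move=> bB e0; apply/dual_nbhsP; exists B; split => //; exists e => // g.
by move=> gB x /gB; rewrite zero_dualE subr0.
Qed.

(** The basic neighbourhoods of zero are the scaled polars of the bounded sets
    [B]; absorbing [A] by one of them is a bound for [A] on [B]. *)
Lemma dual_boundedP (A : set (strong_dual E)) :
  tvs_bounded A <-> forall B, tvs_bounded B ->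
    exists M : R, forall f x, A f -> B x -> `|f x| <= M.
Proof.
split=> [bA B bB|bA U].
  have nU := nbhs_dual0 bB ltr01; have At := bA _ nU.
  near +oo_R => t; exists t => f x Af Bx.
  have : [set t *: u | u in [set f : strong_dual E | forall x, B x -> `|f x| < 1]] f.
    by move: f Af; near: t; exact: At.
  case=> u /= u1 <-; rewrite scale_dualE normrM.
  have t0 : 0 < t by near: t; exact: nbhs_pinfty_gt.
  by rewrite gtr0_norm// ler_piMr ?ltW ?u1.
move=> /dual_nbhsP[B [bB [e e0 BU]]]; have [M MB] := bA B bB.
near=> t => f Af; exists (t^-1 *: f).
  have t0 : 0 < t by near: t; exact: nbhs_pinfty_gt.
  apply: BU => x Bx; rewrite zero_dualE subr0 scale_dualE normrM gtr0_norm ?invr_gt0//.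
  rewrite ltr_pdivrMl//; apply: le_lt_trans (MB f x Af Bx) _.
  rewrite -ltr_pdivrMr//; near: t; apply: nbhs_pinfty_gt; exact: num_real.
rewrite scalerA divff ?scale1r// gt_eqF//; near: t; exact: nbhs_pinfty_gt.
Unshelve. all: by end_near. Qed.

End functionals.

Section bidual.
Variables (R : realType) (E : preTopologicalLmodType R).

(** Continuity at zero provides [B] and one value of [m]; homogeneity gives
    the others. *)
Lemma bidual_bound (Phi : strong_dual (strong_dual E)) :
  exists B, tvs_bounded B /\ exists2 C : R, 0 < C &
    forall (y : strong_dual E) (m : R), 0 < m ->
      (forall x, B x -> `|y x| <= m) -> `|Phi y| <= C * m.
Proof.
have /dual_nbhsP[B [bB [e e0 Be]]] := dual_nbhs0 Phi ltr01.
exists B; split => //; exists (2 / e) => [|y m m0 ym]; first exact: divr_gt0.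
have : `|Phi ((e / (2 * m)) *: y)| < 1.
  apply: Be => x Bx; rewrite zero_dualE subr0 scale_dualE normrM.
  rewrite gtr0_norm ?divr_gt0 ?mulr_gt0//.
  apply: (@le_lt_trans _ _ (e / (2 * m) * m)).
    by rewrite ler_wpM2l ?ym// ltW// divr_gt0// mulr_gt0.
  have -> : e / (2 * m) * m = e / 2 by field; rewrite gt_eqF.
  lra.
rewrite dualZ normrM.
rewrite gtr0_norm ?divr_gt0 ?mulr_gt0// => lt1.
have -> : 2 / e * m = (e / (2 * m))^-1 by field; rewrite !gt_eqF.
by rewrite -[leRHS]mulr1 ler_pdivlMl ?divr_gt0 ?mulr_gt0// ltW.
Qed.

(** The topology of the strong dual is translation invariant, so a linear
    map bounded on one neighbourhood of zero is continuous everywhere. *)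
Lemma bounded_continuous_bidual (Phi : strong_dual E -> R) (B : set E) (C : R) :
  linear (Phi : strong_dual E -> R^o) -> tvs_bounded B ->
  (forall y : strong_dual E, (forall x, B x -> `|y x| <= 1) -> `|Phi y| <= C) ->
  continuous (Phi : strong_dual E -> R^o).
Proof.
move=> lPhi bB BC f W; rewrite nbhs_ballP => -[e /= e0 eW].
have C0 : 0 <= C.
  by apply: le_trans (normr_ge0 _) (BC 0 _) => x _; rewrite zero_dualE normr0.
have d0 : 0 < e / (C + 1) by rewrite divr_gt0// ltr_wpDl.
apply/dual_nbhsP; exists B; split => //; exists (e / (C + 1)) => // g gB.
apply: eW; rewrite -ball_normE /= distrC.
have -> : Phi g - Phi f = (e / (C + 1)) * Phi ((e / (C + 1))^-1 *: (g - f)).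
  have := lPhi (e / (C + 1)) ((e / (C + 1))^-1 *: (g - f)) f.
  by rewrite scalerA divff ?gt_eqF// scale1r subrK => ->; rewrite addrK.
rewrite normrM gtr0_norm//.
have : `|Phi ((e / (C + 1))^-1 *: (g - f))| <= C.
  apply: BC => x Bx; rewrite scale_dualE sub_dualE normrM gtr0_norm ?invr_gt0//.
  by rewrite ler_pdivrMl// mulr1 ltW// gB.
move=> le; apply: le_lt_trans (ler_wpM2l (ltW d0) le) _.
by rewrite -mulrA gtr_pMr// ltr_pdivrMl ?mulr1 ?ltrDl// ltr_wpDl.
Qed.

End bidual.

Section adjoint.
Variables (R : realType) (E F : preTopologicalLmodType R).
Variables (i : E -> F) (li : linear i) (ci : continuous i).

Lemma linear_map0 : i 0 = 0.
Proof. by have := li (-1) 0 0; rewrite scaler0 addr0 scaleN1r addNr. Qed.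

(** This is why transposition is continuous for the strong topologies. *)
Lemma linear_image_bounded (B : set E) : tvs_bounded B -> tvs_bounded (i @` B).
Proof.
move=> bB U nU; have nV : nbhs 0 (i @^-1` U) by apply: ci; rewrite linear_map0.
have := bB _ nV; apply: filterS => t Bt _ [x /Bt[u /= Uu <-] <-].
exists (i u) => //; have := li t u 0.
by rewrite linear_map0 !addr0.
Qed.

Lemma adjoint_linear (f : strong_dual F) : linear (f \o i : E -> R^o).
Proof. by move=> a x y; rewrite /= li dual_combE. Qed.

Lemma adjoint_continuous_functional (f : strong_dual F) :
  continuous (f \o i : E -> R^o).
Proof.
by move=> x; apply: continuous_comp; [exact: ci|exact: (@dual_continuous _ _ f)].
Qed.

Definition adjoint (f : strong_dual F) : strong_dual E :=
  mk_dual (adjoint_linear f) (@adjoint_continuous_functional f).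

Lemma adjointE f x : adjoint f x = f (i x). Proof. by []. Qed.

Lemma linear_adjoint : linear adjoint.
Proof. by move=> a f g; apply: dual_eqP. Qed.

Lemma continuous_adjoint : continuous adjoint.
Proof.
move=> f W /dual_nbhsP[B [bB [e e0 BW]]]; apply/dual_nbhsP.
exists (i @` B); split; first exact: linear_image_bounded.
exists e => // g gB; apply: BW => x Bx; apply: gB; by exists x.
Qed.

End adjoint.

(** A space that is a continuous linear retract of another one inherits
    reflexivity and the separability of the dual; a factor of a power is such a
    retract. *)
Section retract.
Variables (R : realType) (E F : preTopologicalLmodType R).
Variables (i : E -> F) (r : F -> E).
Hypotheses (li : linear i) (ci : continuous i).
Hypotheses (lr : linear r) (cr : continuous r) (ir : cancel i r).

(** The double transposes of [i] and [r] exhibit the bidual of [E] as a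
    retract of the bidual of [F], compatibly with the evaluation maps. *)
Lemma retract_reflexive : is_reflexive F -> is_reflexive E.
Proof.
move=> [J [K [JE JK KJ cJ cK]]].
pose iaa := adjoint (linear_adjoint li ci) (@continuous_adjoint _ _ _ _ li ci).
pose raa := adjoint (linear_adjoint lr cr) (@continuous_adjoint _ _ _ _ lr cr).
exists (fun x => raa (J (i x))), (fun Phi => r (K (iaa Phi))).
have JEE x (f : strong_dual E) : raa (J (i x)) f = f x.
  by rewrite adjointE JE adjointE ir.
split => //.
- move=> x /=; rewrite -[RHS]ir; congr r; rewrite -[RHS]JK; congr K.
  by apply: dual_eqP => f; rewrite adjointE JEE JE adjointE.
- move=> Phi; apply: dual_eqP => f; rewrite JEE.
  rewrite -[LHS](adjointE lr cr) -JE KJ adjointE; congr (Phi _).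
  by apply: dual_eqP => x; rewrite !adjointE ir.
- move=> x; apply: continuous_comp; last exact: continuous_adjoint.
  by apply: continuous_comp; [exact: ci|exact: cJ].
- move=> x; apply: continuous_comp; last exact: cr.
  by apply: continuous_comp; [exact: continuous_adjoint|exact: cK].
Qed.

(** The transpose of [i] is a continuous surjection, with the transpose of
    [r] as a section. *)
Lemma retract_separable_dual : has_separable_dual F -> has_separable_dual E.
Proof.
move=> [D cD dD]; pose ia := adjoint li ci.
exists (ia @` D); first exact: sub_countable (card_image_le _ _) cD.
move=> O [f Of] oO.
have oV : open (ia @^-1` O).
  by apply: open_comp oO => g _; exact: continuous_adjoint.
have [|g [Og Dg]] := dD _ _ oV; last by exists (ia g); split => //; exists g.
exists (adjoint lr cr f); rewrite /preimage /=.
suff -> : ia (adjoint lr cr f) = f by [].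
by apply: dual_eqP => x; rewrite !adjointE ir.
Qed.

End retract.

(** * Spaces graded by a sequence of seminorms *)

(** The last condition speaks of the neighbourhoods of every point: it is what
    makes the topology of [E] compatible with its vector space structure. *)
Definition graded (R : realType) (E : preTopologicalLmodType R)
    (p : nat -> E -> R) : Prop :=
  [/\ forall n x y, p n (x + y) <= p n x + p n y,
      forall n a x, p n (a *: x) = `|a| * p n x,
      forall n x, p n x <= p n.+1 x &
      forall x A, nbhs x A <-> exists n, exists2 e : R, 0 < e &
        [set y | p n (y - x) < e] `<=` A].

Section graded_space.
Variables (R : realType) (E : preTopologicalLmodType R) (p : nat -> E -> R).
Hypothesis gp : graded p.
Implicit Types (x y : E) (A B : set E).

Let pD n x y : p n (x + y) <= p n x + p n y. Proof. by case: gp. Qed.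
Let pZ n a x : p n (a *: x) = `|a| * p n x. Proof. by case: gp. Qed.
Let pS n x : p n x <= p n.+1 x. Proof. by case: gp. Qed.
Let pnbhs x A : nbhs x A <-> exists n, exists2 e : R, 0 < e &
        [set y | p n (y - x) < e] `<=` A. Proof. by case: gp. Qed.

Lemma graded0 n : p n 0 = 0.
Proof. by rewrite -(scale0r 0) pZ normr0 mul0r. Qed.

Lemma gradedN n x : p n (- x) = p n x.
Proof. by rewrite -scaleN1r pZ normrN1 mul1r. Qed.

Lemma graded_ge0 n x : 0 <= p n x.
Proof.
have := pD n x (- x); rewrite subrr graded0 gradedN -mulr2n.
by rewrite pmulrn_lge0.
Qed.

Lemma graded_le m n x : (m <= n)%N -> p m x <= p n x.
Proof.
move/subnK <-; elim: (n - m)%N => [|k IH]; first by rewrite add0n.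
by rewrite addSn; apply: le_trans (pS _ _).
Qed.

Lemma graded_nbhs n (e : R) : 0 < e -> nbhs 0 [set x | p n x < e].
Proof.
by move=> e0; apply/pnbhs; exists n, e => // x /=; rewrite subr0.
Qed.

Lemma graded_boundedP B : tvs_bounded B <->
  forall n, exists M : R, forall x, B x -> p n x <= M.
Proof.
split=> [bB n|bB U /pnbhs[n [e e0 eU]]].
  have [t t0 Bt] := bounded_absorb bB (graded_nbhs n ltr01).
  exists t => x /Bt[u /= u1 <-]; rewrite pZ gtr0_norm//.
  by rewrite ler_piMr ?ltW.
have [M MB] := bB n; near=> t => x Bx.
have t0 : 0 < t by near: t; exact: nbhs_pinfty_gt.
exists (t^-1 *: x); last by rewrite scalerA divff ?scale1r// gt_eqF.
apply: eU; rewrite /= subr0 pZ gtr0_norm ?invr_gt0// ltr_pdivrMl//.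
apply: le_lt_trans (MB _ Bx) _.
rewrite -ltr_pdivrMr//; near: t; apply: nbhs_pinfty_gt; exact: num_real.
Unshelve. all: by end_near. Qed.

(** A neighbourhood of zero on which [f] is at most one contains a ball of
    some [p n]; homogeneity concludes. *)
Lemma graded_dual_bound (f : strong_dual E) :
  exists n, exists2 C : R, 0 < C & forall x, `|f x| <= C * p n x.
Proof.
have /pnbhs[n [e e0 eU]] := dual_nbhs0 f ltr01.
exists n, (2 / e) => [|x]; first exact: divr_gt0.
(* The point [x] is scaled by [s] and not by [p n x], which may vanish. *)
apply/ler_addgt0Pl => d d0.
pose s := 2 / e * p n x + d.
have s0 : 0 < s.
  by rewrite ltr_wpDl// mulr_ge0 ?graded_ge0// divr_ge0// ltW.
rewrite addrC -/s -[leRHS]mulr1 -ler_pdivrMl// -[s^-1]gtr0_norm ?invr_gt0//.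
rewrite -normrM -dualZ ltW//; apply: eU.
rewrite /= subr0 pZ gtr0_norm ?invr_gt0// ltr_pdivrMl//.
have -> : s * e = 2 * p n x + d * e by rewrite /s; field; rewrite gt_eqF.
have := graded_ge0 n x; have := mulr_gt0 d0 e0; lra.
Qed.

Lemma graded_dual_continuous (f : E -> R) n (C : R) :
  linear (f : E -> R^o) -> (forall x, `|f x| <= C * p n x) ->
  continuous (f : E -> R^o).
Proof.
move=> lf fC x W; rewrite nbhs_ballP => -[e /= e0 eW].
have d0 : 0 < e / (`|C| + 1) by rewrite divr_gt0// ltr_wpDl.
apply/pnbhs; exists n, (e / (`|C| + 1)) => // y /= yx.
apply: eW; rewrite -ball_normE /= distrC.
have -> : f y - f x = f (y - x).
  by rewrite [y - x]addrC -[- x]scaleN1r lf scaleN1r addrC.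
apply: le_lt_trans (fC _) _.
apply: (@le_lt_trans _ _ (`|C| * p n (y - x))).
  by apply: ler_wpM2r (ler_norm _); exact: graded_ge0.
move: yx; rewrite ltr_pdivlMr ?ltr_wpDl// => yx.
have := graded_ge0 n (y - x); nra.
Qed.

Lemma bounded_set1 x : tvs_bounded [set x].
Proof.
by apply/graded_boundedP => n; exists (p n x) => _ ->.
Qed.

Lemma evaluation_linear x : linear ((fun f : strong_dual E => f x) : _ -> R^o).
Proof. by []. Qed.

Lemma evaluation_continuous x :
  continuous ((fun f : strong_dual E => f x) : _ -> R^o).
Proof.
apply: (@bounded_continuous_bidual R E _ [set x] 1); first exact: evaluation_linear.
- exact: bounded_set1.
- by move=> y; exact.
Qed.

Definition evaluation x : strong_dual (strong_dual E) :=
  mk_dual (evaluation_linear x) (@evaluation_continuous x).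

(** Otherwise there are functionals [y_n] in [A] and points [x_n] such that
    [p n x_n <= 1] and [n < `|y_n x_n|].  For a fixed seminorm [p m] all the
    [x_n] with [m <= n] lie in its unit ball, so the sequence [x_n] is bounded,
    and [A] should be uniformly bounded on it. *)
Lemma dual_bounded_equicontinuous (A : set (strong_dual E)) : tvs_bounded A ->
  exists n, exists2 C : R, 0 < C & forall f x, A f -> `|f x| <= C * p n x.
Proof.
move=> /dual_boundedP bA; apply: contrapT => nA.
have /choice[yx yxP] n : exists yx : strong_dual E * E,
    [/\ A yx.1, p n yx.2 <= 1 & n%:R < `|yx.1 yx.2|].
  apply: contrapT => nyx; apply: nA; exists n, (n%:R + 1) => [|f x Af].
    by rewrite ltr_wpDl.
  have small y : p n y <= 1 -> `|f y| <= n%:R.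
    move=> y1; rewrite leNgt; apply/negP => fy; apply: nyx.
    by exists (f, y).
  (* On the kernel of the seminorm, [small] holds for all multiples of [x]. *)
  have [px0|px0] := eqVneq (p n x) 0.
    rewrite px0 mulr0 leNgt; apply/negP => fx0.
    have := small ((n%:R + 1) / `|f x| *: x).
    rewrite pZ px0 mulr0 => /(_ ler01); rewrite dualZ normrM normrM.
    rewrite normfV normr_id divfK ?gt_eqF// ger0_norm ?addr_ge0//.
    by rewrite gerDl ler10.
  have px : 0 < p n x by rewrite lt_neqAle eq_sym px0 graded_ge0.
  have := small ((p n x)^-1 *: x).
  rewrite pZ gtr0_norm ?invr_gt0// mulVf// => /(_ (lexx _)).
  rewrite dualZ normrM gtr0_norm ?invr_gt0// ler_pdivrMl// => /le_trans; apply.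
  by rewrite mulrC ler_pM2r// lerDl.
have bx : tvs_bounded (range (fun n => (yx n).2)).
  apply/graded_boundedP => n.
  exists (1 + \sum_(k < n) p n (yx k).2) => _ [k _ <-].
  have [kn|nk] := ltnP k n.
    rewrite (bigD1 (Ordinal kn))//= addrCA lerDl addr_ge0// sumr_ge0// => i _.
    exact: graded_ge0.
  apply: le_trans (graded_le _ nk) _.
  have [_ + _] := yxP k; move=> /le_trans; apply; rewrite lerDl sumr_ge0// => i _.
  exact: graded_ge0.
have [M MP] := bA _ bx; have [Ay _] := yxP (Num.truncn M).+1.
apply/negP; rewrite -leNgt; apply: le_trans (MP _ _ Ay _) _.
  by exists (Num.truncn M).+1.
exact/ltW/truncnS_gt.
Qed.

(** Continuity of the evaluation map for the strong topology of the bidual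
    is the equicontinuity of the bounded sets of functionals. *)
Lemma continuous_evaluation : continuous evaluation.
Proof.
move=> x W /dual_nbhsP[A [bA [e e0 AW]]].
have [n [C C0 AC]] := dual_bounded_equicontinuous bA.
apply/pnbhs; exists n, (e / C); first exact: divr_gt0.
move=> y /= yx; apply: AW => f Af.
have -> : evaluation y f - evaluation x f = (f : strong_dual E) (y - x).
  by rewrite dualB.
by apply: le_lt_trans (AC _ _ Af) _; rewrite mulrC -ltr_pdivlMr.
Qed.

End graded_space.

(** * Countable powers *)

(** Used to distribute an error over [n] terms; adding one to [n] covers the
    empty sum. *)
Lemma sum_share_lt (R : realType) (n : nat) (e : R) : 0 < e ->
  \sum_(i < n) (e / (n%:R + 1)) < e.
Proof.
move=> e0; rewrite sumr_const card_ord -[_ *+ n]mulr_natr -mulrA gtr_pMr//.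
by rewrite mulrC ltr_pdivrMr ?mul1r ?ltrDl// ltr_wpDl.
Qed.

Lemma countable_range (T : choiceType) (x0 : T) (D : set T) : countable D ->
  exists d : nat -> T, D `<=` range d.
Proof.
move=> /countable_injP[f fI].
exists (fun n => xget x0 [set g | D g /\ f g = n]) => g Dg.
exists (f g) => //; have [] := @xgetPex _ x0 [set h | D h /\ f h = f g].
  by exists g.
by move=> Dh fh; apply: fI => //; exact/mem_set.
Qed.

Section countable_powers.
Variables (R : realType) (X : normedModType R).
Let XN := countable_power X.
Implicit Types (x y : XN) (n k : nat).

Definition power_seminorm n x : R := \sum_(i < n) `|x i|.

Lemma le_power_seminorm n x (i : 'I_n) : `|x i| <= power_seminorm n x.
Proof. by rewrite /power_seminorm (bigD1 i)//= lerDl sumr_ge0. Qed.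

Lemma power_coordinate_continuous k : continuous ((fun x => x k) : XN -> X).
Proof. exact: (@proj_continuous nat (fun _ => X) k). Qed.

(** The filter of the balls of the seminorms converges coordinatewise to
    its centre, hence in the product topology; conversely a ball constrains
    finitely many coordinates. *)
Lemma power_graded : graded power_seminorm.
Proof.
split.
- by move=> n x y; rewrite -big_split; apply: ler_sum => i _; exact: ler_normD.
- by move=> n a x; rewrite mulr_sumr; apply: eq_bigr => i _; rewrite -normrZ.
- by move=> n x; rewrite /power_seminorm big_ord_recr lerDl.
move=> x A; split=> [|[n [e e0 eA]]]; last first.
  have ny : nbhs x [set y | forall i : 'I_n, `|y i - x i| < e / (n%:R + 1)].
    apply: (@filter_forall _ _ (fun (i : 'I_n) (y : XN) =>
      `|y i - x i| < e / (n%:R + 1)) (nbhs x)) => i.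
    have d0 : 0 < e / (n%:R + 1) by rewrite divr_gt0// ltr_wpDl.
    have nxi : nbhs (x i) [set u : X | `|u - x i| < e / (n%:R + 1)].
      by apply/nbhs_normP; exists (e / (n%:R + 1)) => // u; rewrite /= distrC.
    exact: (@power_coordinate_continuous i x _ nxi).
  apply: filterS ny => y /= yx; apply: eA => /=.
  apply: (@le_lt_trans _ _ (\sum_(i < n) (e / (n%:R + 1)))).
    by apply: ler_sum => i _; exact/ltW/yx.
  exact: sum_share_lt.
pose F : set_system XN := filter_from [set ne : nat * R | 0 < ne.2]
  (fun ne => [set y | power_seminorm ne.1 (y - x) < ne.2]).
have FF : Filter F.
  apply: filter_from_filter; first by exists (0%N, 1) => //=.
  move=> [m a] [n b] /= a0 b0; exists (maxn m n, Num.min a b) => /=.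
    by rewrite lt_min a0.
  have le k l y : (k <= l)%N -> power_seminorm k y <= power_seminorm l y.
    move/subnK <-; elim: (l - k)%N => [|j IH]; first by rewrite add0n.
    by rewrite addSn; apply: le_trans IH _; rewrite /power_seminorm big_ord_recr lerDl.
  move=> y /=; rewrite lt_min => /andP[ya yb]; split.
    exact: le_lt_trans (le _ _ _ (leq_maxl _ _)) ya.
  exact: le_lt_trans (le _ _ _ (leq_maxr _ _)) yb.
have /(_ A) Fx : F --> (x : {ptws nat -> X}).
  apply/pointwise_cvgP => k W; rewrite nbhs_ballP => -[e /= e0 eW].
  exists (k.+1, e) => //= y /= ye; apply: eW; rewrite -ball_normE /= distrC.
  exact: le_lt_trans (le_power_seminorm (y - x) ord_max) ye.
by move=> /Fx[[n e] /= e0 eA]; exists n, e.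
Qed.

Definition power_single k (u : X) : XN := fun i => if i == k then u else 0.

Lemma power_single_linear k : linear (power_single k).
Proof.
move=> a u v; apply/funext => i; rewrite /power_single.
have -> : (a *: (fun j => if j == k then u else 0) +
   (fun j => if j == k then v else 0) : nat -> X) i =
   a *: (if i == k then u else 0) + (if i == k then v else 0) by [].
by case: ifP => _ //; rewrite scaler0 addr0.
Qed.

Lemma power_coordinate_linear k : linear ((fun x => x k) : XN -> X).
Proof. by []. Qed.

Lemma power_single_continuous k : continuous (power_single k).
Proof.
have [_ _ _ pn] := power_graded.
move=> u W /pn[n [e e0 eW]]; apply/nbhs_normP; exists e => //= v /= uv.
apply: eW => /=; apply: le_lt_trans uv; rewrite distrC.
have -> : power_seminorm n (power_single k v - power_single k u) =
    \sum_(i < n) if (i : nat) == k then `|v - u| else 0.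
  apply: eq_bigr => i _.
  have -> : (power_single k v - power_single k u) i =
    power_single k v i - power_single k u i by [].
  by rewrite /power_single; case: ifP => // _; rewrite subrr normr0.
have [kn|nk] := ltnP k n.
  rewrite (bigD1 (Ordinal kn))//= eqxx big1 ?addr0// => i; rewrite -val_eqE /=.
  by move=> /negPf ->.
by rewrite big1// => i _; rewrite ltn_eqF// (leq_trans _ nk).
Qed.

Lemma power_singleK k : cancel (power_single k) (fun x => x k).
Proof. by move=> u; rewrite /power_single eqxx. Qed.

Definition power_restrict k : strong_dual XN -> strong_dual X :=
  adjoint (power_single_linear k) (@power_single_continuous k).

Definition power_extend k : strong_dual X -> strong_dual XN :=
  adjoint (power_coordinate_linear k) (@power_coordinate_continuous k).

(** A functional is bounded by one of the seminorms, so it vanishes on the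
    sequences whose first coordinates are zero, and the dual of the power is the
    direct sum of the duals. *)
Lemma power_dual_finite (f : strong_dual XN) : exists n,
  f = \sum_(k < n) power_extend k (power_restrict k f).
Proof.
have [n [C C0 fC]] := graded_dual_bound power_graded f.
exists n; apply: dual_eqP => x; rewrite sum_dualE.
under eq_bigr do rewrite !adjointE.
rewrite -dual_sum; apply/eqP; rewrite -subr_eq0 -dualB -normr_le0.
apply: le_trans (fC _) _; rewrite /power_seminorm big1 ?mulr0// => i _.
apply/normr0P/eqP.
have sumE (s : seq 'I_n) (F : 'I_n -> XN) j :
    (\sum_(k <- s) F k) j = \sum_(k <- s) F k j.
  by elim/big_rec2: _ => // k y z _ <-.
have -> : (x - \sum_(k < n) power_single k (x k)) i =
  x i - (\sum_(k < n) power_single k (x k)) i by [].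
rewrite sumE (bigD1 i)//= power_singleK big1 ?addr0 ?subrr// => j ji.
by rewrite /power_single; case: eqP => // /val_inj e; rewrite e eqxx in ji.
Qed.

(** An element of the bidual of the power restricts to an element of the
    bidual of each factor, where reflexivity gives a coordinate.  These
    coordinates represent it because every functional is a finite sum of
    functionals of single coordinates. *)
Theorem reflexive_countable_power : is_reflexive X -> is_reflexive XN.
Proof.
move=> [J [K [JE JK KJ cJ cK]]].
pose Jn := evaluation power_graded.
pose pr k : strong_dual (strong_dual XN) -> strong_dual (strong_dual X) :=
  adjoint (linear_adjoint (power_coordinate_linear k) (@power_coordinate_continuous k))
    (@continuous_adjoint _ _ _ _ (power_coordinate_linear k) (@power_coordinate_continuous k)).
pose Kn (Phi : strong_dual (strong_dual XN)) : XN := fun k => K (pr k Phi).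
exists Jn, Kn; split => //.
- move=> x; apply/funext => k; rewrite /Kn -[RHS]JK; congr K.
  by apply: dual_eqP => f; rewrite JE.
- move=> Phi; apply: dual_eqP => f.
  have -> : Jn (Kn Phi) f = (f : strong_dual XN) (Kn Phi) by [].
  have [n ->] := power_dual_finite f.
  rewrite dual_sum sum_dualE; apply: eq_bigr => k _.
  transitivity (J (K (pr k Phi)) (power_restrict k f)); first by rewrite JE.
  by rewrite KJ.
- exact: continuous_evaluation.
move=> Phi; have FF := fmap_filter Kn (nbhs_filter Phi).
apply/(@pointwise_cvgP nat X (Kn @ Phi) (Kn Phi)) => k.
have : continuous (K \o pr k).
  move=> Psi; apply: continuous_comp; last exact: cK.
  exact: continuous_adjoint.
exact.
Qed.

(** Finite sums of functionals of single coordinates, taken in a dense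
    sequence, are dense. *)
Theorem separable_dual_countable_power :
  has_separable_dual X -> has_separable_dual XN.
Proof.
move=> [D cD dD].
have [d Dd] : exists d : nat -> strong_dual X, D `<=` range d.
  exact: (@countable_range (strong_dual X) 0 D cD).
pose s (l : seq nat) : strong_dual XN :=
  \sum_(k < size l) power_extend k (d (nth 0%N l k)).
exists (range s); first exact: sub_countable (card_image_le _ _) (countableP _).
move=> O [f Of] oO.
have /dual_nbhsP[B [bB [e e0 BO]]] : nbhs f O by exact: open_nbhs_nbhs.
have [n fE] := power_dual_finite f.
pose e' := e / (n%:R + 1); have e'0 : 0 < e' by rewrite divr_gt0// ltr_wpDl.
have /choice[m mP] k : exists m, forall x, B x ->
    `|d m (x k) - power_restrict k f (x k)| < e'.
  pose Bk := [set x k | x in B].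
  have bBk : tvs_bounded Bk.
    apply: (linear_image_bounded (power_coordinate_linear k)) bB.
    exact: power_coordinate_continuous.
  pose V := [set g : strong_dual X |
    forall u, Bk u -> `|g u - power_restrict k f u| < e'].
  have nV : nbhs (power_restrict k f) V.
    by apply/dual_nbhsP; exists Bk; split => //; exists e'.
  have [|g [Vg Dg]] := dD V^° _ (@open_interior _ V); first by exists (power_restrict k f).
  have [m _ dm] := Dd _ Dg; exists m => x Bx; rewrite dm.
  by apply: (interior_subset Vg); exists x.
exists (s (mkseq m n)); split; last by exists (mkseq m n).
apply: BO => x Bx; rewrite [in X in _ - X]fE /s size_mkseq !sum_dualE -sumrB.
apply: le_lt_trans (ler_norm_sum _ _ _) _.
apply: (@le_lt_trans _ _ (\sum_(i < n) e')).
  by apply: ler_sum => i _; rewrite nth_mkseq// !adjointE; exact/ltW/mP.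
exact: sum_share_lt.
Qed.

Theorem reflexive_countable_power_iff : is_reflexive X <-> is_reflexive XN.
Proof.
split; first exact: reflexive_countable_power.
exact: (retract_reflexive (power_single_linear 0) (@power_single_continuous 0)
  (power_coordinate_linear 0) (@power_coordinate_continuous 0) (power_singleK 0)).
Qed.

Theorem separable_dual_countable_power_iff :
  has_separable_dual X <-> has_separable_dual XN.
Proof.
split; first exact: separable_dual_countable_power.
exact: (retract_separable_dual (power_single_linear 0) (@power_single_continuous 0)
  (power_coordinate_linear 0) (@power_coordinate_continuous 0) (power_singleK 0)).
Qed.

End countable_powers.

(** * Spaces of continuous functions on the line *)

Section sup_norms.
Variable R : realType.
Implicit Types (f g : R -> R) (n : nat).

Definition sup_norm n f : R := sup [set `|f t| | t in [set t | `|t| <= n%:R]].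

Lemma norm_segment n : [set t : R | `|t| <= n%:R] = `[- n%:R, n%:R]%classic.
Proof. by apply/seteqP; split=> t /=; rewrite in_itv /= ler_norml. Qed.

Lemma le_sup_norm n f t : continuous (f : R -> R^o) -> `|t| <= n%:R ->
  `|f t| <= sup_norm n f.
Proof.
move=> cf tn; apply: sup_upper_bound; last by exists t.
rewrite /sup_norm norm_segment.
apply: compact_has_sup.
  by exists `|f t|; exists t => //; rewrite -norm_segment.
apply: continuous_compact; last exact: segment_compact.
apply: continuous_subspaceT => u.
apply: (@continuous_comp R R^o R f); first exact: cf.
exact: norm_continuous.
Qed.

Lemma sup_norm_le n f M :
  (forall t, `|t| <= n%:R -> `|f t| <= M) -> sup_norm n f <= M.
Proof.
move=> fM; apply: ge_sup; last by move=> _ [t tn <-]; exact: fM.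
by exists `|f 0|; exists 0 => //=; rewrite normr0.
Qed.

End sup_norms.

Section spaces_of_continuous_functions.
Variable R : realType.
Implicit Types (x y : CR R) (n : nat).

Definition cfun x : R -> R := proj1_sig x.

Lemma cfun_continuous x : continuous (cfun x : R -> R^o).
Proof. by case: x => x xP; have := xP; rewrite inE. Qed.

Lemma mem_continuous_functions (f : R -> R) : continuous (f : R -> R^o) ->
  (f : {family compact, R -> R^o})
    \in lsubspace_pred (LSubspace (@continuous_functions_closed R)).
Proof. by move=> cf; rewrite inE. Qed.

Definition mk_cfun (f : R -> R) (cf : continuous (f : R -> R^o)) : CR R :=
  exist _ f (mem_continuous_functions cf).

Lemma cfunD x y t : cfun (x + y) t = cfun x t + cfun y t. Proof. by []. Qed.
Lemma cfunB x y t : cfun (x - y) t = cfun x t - cfun y t. Proof. by []. Qed.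
Lemma cfunZ a x t : cfun (a *: x) t = a * cfun x t. Proof. by []. Qed.
Lemma cfun0 t : cfun 0 t = 0. Proof. by []. Qed.

Lemma cfun_sum (I : Type) (s : seq I) (F : I -> CR R) t :
  cfun (\sum_(i <- s) F i) t = \sum_(i <- s) cfun (F i) t.
Proof. by elim/big_rec2: _ => // i y z _ <-. Qed.

Lemma cfunP x y : (forall t, cfun x t = cfun y t) -> x = y.
Proof. by move=> xy; apply: val_inj; apply/funext. Qed.

Definition CR_norm n x : R := sup_norm n (cfun x).

Lemma le_CR_norm n x t : `|t| <= n%:R -> `|cfun x t| <= CR_norm n x.
Proof. by move=> tn; apply: le_sup_norm => //; exact: cfun_continuous. Qed.

(** Compact subsets of the line are bounded and the segments are compact. *)
Lemma CR_graded : graded CR_norm.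
Proof.
split.
- move=> n x y; apply: sup_norm_le => t tn; rewrite cfunD.
  by apply: le_trans (ler_normD _ _) _; rewrite lerD ?le_CR_norm.
- have le n a x : CR_norm n (a *: x) <= `|a| * CR_norm n x.
    apply: sup_norm_le => t tn; rewrite cfunZ normrM.
    by rewrite ler_wpM2l ?le_CR_norm.
  move=> n a x; apply/eqP; rewrite eq_le le /=.
  have [->|a0] := eqVneq a 0.
    rewrite normr0 mul0r scale0r; apply: le_trans (normr_ge0 (cfun 0 0)) _.
    by apply: le_CR_norm; rewrite normr0.
  have := le n a^-1 (a *: x); rewrite scalerA mulVf// scale1r normfV.
  by rewrite ler_pdivlMl// normr_gt0.
- move=> n x; apply: sup_norm_le => t tn; apply: le_CR_norm.
  by apply: le_trans tn _; rewrite ler_nat.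
move=> x A; split=> [/space_of_nbhsP[V]|[n [e e0 eA]]].
  move=> /(family_nbhsP (@compact0 R) (@compactU R))[B [cB [e e0 BV]]] VA.
  have [M [_ MB]] := @compact_bounded R R^o B cB.
  exists (Num.truncn (M + 1)).+1, e => // y /= ye; apply: VA; apply: BV => t Bt.
  apply: le_lt_trans ye; rewrite -[leLHS]/(`|cfun (y - x) t|); apply: le_CR_norm.
  apply: le_trans (ltW (truncnS_gt (M + 1))).
  by apply: MB => //; rewrite ltrDl.
apply/space_of_nbhsP.
exists [set f : R -> R^o | forall t, [set t : R | `|t| <= n%:R] t ->
    `|f t - cfun x t| < e / 2].
  apply/(family_nbhsP (@compact0 R) (@compactU R)).
  exists [set t : R | `|t| <= n%:R]; split.
    by rewrite norm_segment; exact: segment_compact.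
  by exists (e / 2) => //; rewrite divr_gt0.
move=> y yx; apply: eA => /=; apply: (@le_lt_trans _ _ (e / 2)); last lra.
by apply: sup_norm_le => t tn; exact/ltW/yx.
Qed.

End spaces_of_continuous_functions.

Lemma graded_subspace (R : realType) (E : preTopologicalLmodType R)
    (p : nat -> E -> R) (A : lsubspace E) : graded p ->
  graded (fun n (x : space_of A) => p n (val x)).
Proof.
move=> [pD pZ pS pn]; split.
- by move=> n x y; exact: pD.
- by move=> n a x; exact: pZ.
- by move=> n x; exact: pS.
move=> x W; rewrite space_of_nbhsP; split.
  move=> [V /pn[n [e e0 eV]] VW]; exists n, e => // y ye; apply: VW.
  exact: eV.
move=> [n [e e0 eW]]; exists [set y | p n (y - val x) < e].
  by apply/pn; exists n, e.
by move=> y; exact: eW.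
Qed.

(** * Functions with independent signs *)

Section independent_signs.
Variable R : realType.
Implicit Types (v t : R) (eps : nat -> bool).

(** The three definitions below form a system of functions taking the values
    one and minus one independently: [unfold3] maps each of the two segments
    [1/3 <= v <= 1] and [-1 <= v <= -1/3] onto [-1 <= v <= 1], while [clamp3] is
    constant, with opposite signs, on these segments.  The composites of [clamp3]
    with the iterates of [unfold3] read off the itinerary of a point. *)
Definition clamp3 v : R := Num.max (-1) (Num.min 1 (3 * v)).
Definition unfold3 v : R := 3 * `|v| - 2.
Definition sign_fun i v : R := clamp3 (iter i unfold3 v).
Definition sgn_of (b : bool) : R := if b then 1 else -1.

Lemma sgn_norm b : `|sgn_of b| = 1.
Proof. by case: b; rewrite /= ?normrN normr1. Qed.

Lemma continuous_clamp3 : continuous (clamp3 : R -> R^o).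
Proof.
move=> v.
apply: (@continuous_max R R (cst (-1)) (cst 1 \min (fun v => 3 * v)) v).
  exact: (@cvg_cst R^o).
apply: (@continuous_min R R (cst 1) (fun v => 3 * v) v).
  exact: (@cvg_cst R^o).
by apply: (@cvgMl_tmp R); exact: cvg_id.
Qed.

Lemma continuous_unfold3 : continuous (unfold3 : R -> R^o).
Proof.
move=> v; apply: (@cvgB R R^o); last exact: (@cvg_cst R^o).
by apply: (@cvgMl_tmp R); exact: norm_continuous.
Qed.

Lemma continuous_sign_fun i : continuous (sign_fun i : R -> R^o).
Proof.
have ci : continuous (iter i unfold3 : R -> R^o).
  elim: i => [|i IH] v; first exact: cvg_id.
  apply: (@continuous_comp R R R (iter i unfold3) unfold3 v); first exact: IH.
  exact: continuous_unfold3.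
move=> v; apply: (@continuous_comp R R R (iter i unfold3) clamp3 v); first exact: ci.
exact: continuous_clamp3.
Qed.

Lemma sign_fun_le1 i v : `|sign_fun i v| <= 1.
Proof.
rewrite ler_norml /sign_fun /clamp3 le_max lexx /= ge_max ge_min lexx/= andbT.
lra.
Qed.

Lemma clamp3_sgn b v : 1 <= 3 * (sgn_of b * v) -> clamp3 v = sgn_of b.
Proof.
rewrite /clamp3; case: b => /= v1.
  rewrite min_l; last by rewrite mul1r in v1.
  by rewrite max_r//; lra.
rewrite min_r; last lra.
by rewrite max_l//; lra.
Qed.

(** Prescribing one more sign at the head of the itinerary amounts to choosing
    one of the two preimages by [unfold3]. *)
Lemma finite_signs n eps : exists v, `|v| <= 1 /\
  forall i, (i < n)%N -> sign_fun i v = sgn_of (eps i).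
Proof.
elim: n eps => [|n IH] eps; first by exists 0; rewrite normr0.
have [v [v1 vs]] := IH (eps \o S).
have v2 : 0 < (v + 2) / 3 by have := ler_normlW v1; move: v1; rewrite ler_norml; lra.
exists (sgn_of (eps 0%N) * ((v + 2) / 3)); rewrite normrM sgn_norm mul1r.
rewrite gtr0_norm//; split; first by move: v1; rewrite ler_norml; lra.
case=> [|i] lt_in; last first.
  rewrite /sign_fun iterSr /unfold3 -/unfold3 normrM sgn_norm mul1r gtr0_norm//.
  have -> : 3 * ((v + 2) / 3) - 2 = v by field.
  exact: vs.
apply: clamp3_sgn; rewrite [X in _ * X]mulrA.
have -> : sgn_of (eps 0%N) * sgn_of (eps 0%N) = 1.
  by case: (eps 0%N); rewrite /= ?mulrNN mulr1.
by move: v1; rewrite ler_norml; lra.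
Qed.

(** Compactness: a cluster point of points realizing longer and longer finite
    patterns realizes the infinite one, since each sign is a closed condition. *)
Lemma infinite_signs eps : exists v, `|v| <= 1 /\
  forall i, sign_fun i v = sgn_of (eps i).
Proof.
have /choice[v vP] n := finite_signs n eps.
have [|w [w1 clw]] := @segment_compact R (-1) 1 (v @ \oo) _.
  by exists 0%N => // n _ /=; rewrite in_itv /= -ler_norml; exact: (vP n).1.
exists w; split; first by move: w1; rewrite /= in_itv /= ler_norml.
move=> i; pose C := [set t | sign_fun i t = sgn_of (eps i)].
have cC : closed C.
  apply: (@closed_comp R R^o (sign_fun i) [set sgn_of (eps i)]).
    by move=> t _; exact: continuous_sign_fun.
  exact: closed_eq.
suff : C w by [].
rewrite (closure_id C).1//; move: clw; rewrite clusterE; apply.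
by exists i.+1 => // n /= lt_in; exact: (vP n).2.
Qed.

(** Composing with a periodic function makes all sign patterns occur
    arbitrarily far on the line. *)
Lemma cos_onto n v : `|v| <= 1 -> exists t : R, n%:R <= t <= n%:R + 1 /\
  cos (2 * pi * t) = v.
Proof.
rewrite ler_norml => v1; have pi0 := pi_gt0 R.
have a0 := acos_ge0 v1; have a1 := acos_lepi v1.
have q0 : 0 <= acos v / (2 * pi) by rewrite divr_ge0// mulr_ge0// ltW.
have q1 : acos v / (2 * pi) <= 1 by rewrite ler_pdivrMr ?mulr_gt0//; lra.
exists (n%:R + acos v / (2 * pi)); split; first by rewrite lerDl q0 lerD2l.
have periods (p a : R) : 0 < p -> 2 * p * (n%:R + a / (2 * p)) = a + p *+ 2 *+ n.
  move=> p0; rewrite -[p *+ 2 *+ n]mulr_natr -[p *+ 2]mulr_natr; field.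
  by rewrite gt_eqF.
rewrite periods//.
by rewrite (periodicn (@cosD2pi R)) acosK// in_itv.
Qed.

End independent_signs.

(** * Köthe spaces of sequences indexed by finite sequences of integers *)

Section koethe.
Variable R : realType.
Implicit Types (s : seq nat) (t u : R) (n : nat) (x y : CR R) (F G : seq (seq nat)).

(** The weight of [s] at [t] is the exponential of this sum.  It is one for
    [`|t| <= 1].  The term of index [j] is zero until [`|t|] reaches [1 + j], so
    that at a given [t] the weights of the prefixes of one infinite sequence are
    bounded; past that value it grows linearly with a slope given by the [j]-th
    entry of [s], so that comparing the weights at two distant points controls
    this entry. *)
Definition exponent s t : R :=
  \sum_(j < size s) (nth 0%N s j)%:R * Num.max 0 (`|t| - 1 - j%:R).

Definition weight s t : R := expR (exponent s t).

Definition basis_fun s t : R :=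
  weight s t * sign_fun (pickle s) (cos (2 * pi * t)).

Lemma continuous_exponent s : continuous (exponent s : R -> R^o).
Proof.
suff sumc k (f : nat -> R -> R^o) : (forall j, continuous (f j)) ->
    continuous ((fun t => \sum_(j < k) f j t) : R -> R^o).
  apply: (sumc (size s)
    (fun j t => (nth 0%N s j)%:R * Num.max 0 (`|t| - 1 - j%:R))) => j t.
  apply: (@cvgMl_tmp R).
  apply: (@continuous_max R R (cst 0) (fun t => `|t| - 1 - j%:R) t).
    exact: (@cvg_cst R^o).
  apply: (@cvgB R R^o); last exact: (@cvg_cst R^o).
  apply: (@cvgB R R^o); last exact: (@cvg_cst R^o).
  exact: norm_continuous.
elim: k => [|k IH] fc t.
  under eq_fun do rewrite big_ord0.
  exact: (@cvg_cst R^o).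
under eq_fun do rewrite big_ord_recr.
by apply: (@cvgD R R^o); [exact: IH|exact: fc].
Qed.

Lemma continuous_basis_fun s : continuous (basis_fun s : R -> R^o).
Proof.
move=> t; apply: (@cvgM R).
  apply: (@continuous_comp R R R (exponent s) expR t).
    exact: continuous_exponent.
  exact: continuous_expR.
apply: (@continuous_comp R R R (fun t => 2 * pi * t)
  (fun u => sign_fun (pickle s) (cos u)) t).
  by apply: (@cvgMl_tmp R); exact: cvg_id.
apply: (@continuous_comp R R R cos (sign_fun (pickle s))).
  exact: continuous_cos.
exact: continuous_sign_fun.
Qed.

Definition basis s : CR R := mk_cfun (@continuous_basis_fun s).

Lemma weight_gt0 s t : 0 < weight s t. Proof. exact: expR_gt0. Qed.

Lemma weight_eq1 s t : `|t| <= 1 -> weight s t = 1.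
Proof.
move=> t1; rewrite /weight /exponent big1 ?expR0// => j _.
rewrite max_l ?mulr0//; have : 0 <= (j : nat)%:R :> R by []; lra.
Qed.

Lemma weight_le s t u : `|t| <= `|u| -> weight s t <= weight s u.
Proof.
move=> tu; rewrite ler_expR; apply: ler_sum => j _; rewrite ler_wpM2l//.
by rewrite ge_max !le_max lexx /=; apply/orP; right; lra.
Qed.

(** The term of index [j] gains at least the [j]-th entry of [s], because
    [n + j + 2] exceeds both [n] and [1 + j] by one or more. *)
Lemma exponent_gap s n j :
  exponent s n%:R + (nth 0%N s j)%:R <= exponent s (n + j + 2)%:R :> R.
Proof.
have mono (i : nat) : Num.max 0 (`|n%:R| - 1 - i%:R) <=
    Num.max 0 (`|(n + j + 2)%:R| - 1 - i%:R) :> R.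
  rewrite ge_max !le_max lexx /=; apply/orP; right.
  by rewrite !ger0_norm// !natrD; have : 0 <= j%:R :> R by []; lra.
have [js|sj] := ltnP j (size s); last first.
  rewrite nth_default// addr0; apply: ler_sum => i _.
  by rewrite ler_wpM2l.
rewrite /exponent (bigD1 (Ordinal js))//= [leRHS](bigD1 (Ordinal js))//=.
rewrite addrAC lerD//; last by apply: ler_sum => i _; rewrite ler_wpM2l.
rewrite -[X in _ + X]mulr1 -mulrDr ler_wpM2l//.
rewrite !ger0_norm// !natrD maxEle.
have n0 : 0 <= n%:R :> R by []; have j0 : 0 <= j%:R :> R by [].
by case: ifP => _; rewrite le_max; apply/orP; right; lra.
Qed.

Lemma basis_combination_le n F (a : seq nat -> R) :
  CR_norm n (\sum_(s <- F) a s *: basis s) <=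
    \sum_(s <- F) weight s n%:R * `|a s|.
Proof.
apply: sup_norm_le => t tn; rewrite -/(cfun _) cfun_sum.
apply: le_trans (ler_norm_sum _ _ _) _; apply: ler_sum => s _.
rewrite cfunZ normrM mulrC ler_wpM2r// normrM.
rewrite (gtr0_norm (weight_gt0 _ _)); apply: (@le_trans _ _ (weight s t)).
  by rewrite ler_piMr ?sign_fun_le1// ltW// weight_gt0.
by apply: weight_le; rewrite [leRHS]ger0_norm.
Qed.

(** At some point between [n] and [n + 1] all the terms of the combination are
    nonnegative, so that nothing cancels.  With the previous lemma, this makes the
    sup norms of a combination equivalent to weighted l1 norms of its
    coefficients. *)
Lemma le_basis_combination n F (a : seq nat -> R) :
  \sum_(s <- F) weight s n%:R * `|a s| <=
    CR_norm n.+1 (\sum_(s <- F) a s *: basis s).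
Proof.
pose eps i := if unpickle i is Some s then 0 <= a s else true.
have [v [v1 vs]] := infinite_signs R eps.
have [t [/andP[nt tn] ct]] := cos_onto n v1.
have t0 : 0 <= t by apply: le_trans nt.
apply: (@le_trans _ _ `|cfun (\sum_(s <- F) a s *: basis s) t|); last first.
  by apply: le_CR_norm; rewrite ger0_norm// -natr1.
rewrite cfun_sum; apply: le_trans (ler_norm _); apply: ler_sum => s _.
rewrite cfunZ /cfun /= /basis_fun ct vs /eps pickleK mulrCA.
have -> : a s * sgn_of R (0 <= a s) = `|a s|.
  by case: ger0P => as0; rewrite ?mulr1 ?mulrN1.
by rewrite ler_wpM2r// weight_le// !ger0_norm.
Qed.

(** The signs are realized where all the weights are equal to one, so that
    basis vectors take the values one and minus one there. *)
Definition sign_point (eps : nat -> bool) : R :=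
  xget 0 [set t | 0 <= t <= 1 /\
    forall i, sign_fun i (cos (2 * pi * t)) = sgn_of R (eps i)].

Lemma sign_pointP eps : 0 <= sign_point eps <= 1 /\
  forall i, sign_fun i (cos (2 * pi * sign_point eps)) = sgn_of R (eps i).
Proof.
apply: (@xgetPex _ 0 [set t : R | 0 <= t <= 1 /\
    forall i, sign_fun i (cos (2 * pi * t)) = sgn_of R (eps i)]).
have [v [v1 vs]] := infinite_signs R eps.
have [t [t01 ct]] := cos_onto 0 v1; exists t; split => [|i]; last by rewrite ct.
by rewrite add0r in t01.
Qed.

Lemma sign_point_norm eps : `|sign_point eps| <= 1.
Proof. by have [/andP[t0 t1] _] := sign_pointP eps; rewrite ger0_norm. Qed.

Lemma basis_sign_point s eps :
  cfun (basis s) (sign_point eps) = sgn_of R (eps (pickle s)).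
Proof.
have [_ ts] := sign_pointP eps; rewrite /cfun /= /basis_fun ts.
by rewrite weight_eq1 ?mul1r// sign_point_norm.
Qed.

(** The sign patterns of the two points differ only at the index of [s], so
    this difference of evaluations extracts a coefficient; being defined on all
    continuous functions, it needs no extension by density. *)
Definition coef s x : R :=
  (cfun x (sign_point (fun=> true)) -
   cfun x (sign_point (fun i => i != pickle s))) / 2.

Lemma coefD s x y : coef s (x + y) = coef s x + coef s y.
Proof. by rewrite /coef !cfunD; field. Qed.

Lemma coefZ s a x : coef s (a *: x) = a * coef s x.
Proof. by rewrite /coef !cfunZ; field. Qed.

Lemma coef0 s : coef s 0 = 0.
Proof. by rewrite /coef !cfun0 subrr mul0r. Qed.

Lemma coefB s x y : coef s (x - y) = coef s x - coef s y.
Proof. by rewrite coefD -scaleN1r coefZ mulN1r. Qed.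

Lemma coef_basis s s' : coef s (basis s') = (s == s')%:R.
Proof.
rewrite /coef !basis_sign_point /=.
rewrite (inj_eq (pcan_inj pickleK)) eq_sym; by case: eqVneq => _ /=; lra.
Qed.

Lemma coef_le s x : `|coef s x| <= CR_norm 1 x.
Proof.
rewrite /coef normrM [`|2^-1|]ger0_norm ?invr_ge0// ler_pdivrMr//.
apply: le_trans (ler_normB _ _) _.
by rewrite mulr_natr mulr2n lerD// le_CR_norm// sign_point_norm.
Qed.

Definition partial_sum F x : CR R := \sum_(s <- F) coef s x *: basis s.

Lemma partial_sumD F x y : partial_sum F (x + y) = partial_sum F x + partial_sum F y.
Proof. by rewrite -big_split; apply: eq_bigr => s _; rewrite coefD scalerDl. Qed.

Lemma partial_sumZ F a x : partial_sum F (a *: x) = a *: partial_sum F x.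
Proof. by rewrite scaler_sumr; apply: eq_bigr => s _; rewrite coefZ scalerA. Qed.

Lemma partial_sumB F x y : partial_sum F (x - y) = partial_sum F x - partial_sum F y.
Proof. by rewrite partial_sumD -scaleN1r partial_sumZ scaleN1r. Qed.

Lemma partial_sum0 F : partial_sum F 0 = 0.
Proof. by rewrite /partial_sum big1// => s _; rewrite coef0 scale0r. Qed.

Lemma partial_sum_basis F s : uniq F -> s \in F -> partial_sum F (basis s) = basis s.
Proof.
move=> uF sF; rewrite /partial_sum (bigD1_seq s)//= coef_basis eqxx scale1r.
rewrite big1 ?addr0// => s' /negPf ss'; by rewrite coef_basis ss' scale0r.
Qed.

Definition combination (L : seq (R * seq nat)) : CR R :=
  \sum_(c <- L) c.1 *: basis c.2.

(** The vectors [basis s] and the functionals [coef s] are biorthogonal. *)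
Lemma partial_sum_combination F L : uniq F -> {subset map snd L <= F} ->
  partial_sum F (combination L) = combination L.
Proof.
move=> uF; rewrite /combination; elim: L => [|c L IH] cF.
  by rewrite big_nil partial_sum0.
rewrite big_cons partial_sumD partial_sumZ partial_sum_basis ?IH//.
  by move=> s sL; apply: cF; rewrite /= inE sL orbT.
by apply: cF; rewrite /= inE eqxx.
Qed.

Section spanned_subspace.
Variable A : set (seq nat).

Definition in_span (L : seq (R * seq nat)) : Prop := forall c, c \in L -> A c.2.

(** Since lists may repeat an index, spans are closed under addition by
    concatenation. *)
Definition closed_span : set (CR R) := [set x | forall n (e : R), 0 < e ->
  exists2 L, in_span L & CR_norm n (x - combination L) < e].

Lemma combination_closed_span L : in_span L -> closed_span (combination L).
Proof.
move=> AL n e e0; exists L => //.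
by rewrite subrr (graded0 (@CR_graded R)).
Qed.

Lemma basis_closed_span s : A s -> closed_span (basis s).
Proof.
move=> As; have -> : basis s = combination [:: (1, s)].
  by rewrite /combination big_seq1 scale1r.
by apply: combination_closed_span => c; rewrite inE => /eqP ->.
Qed.

Lemma closed_span_submod : submod_closed [in closed_span].
Proof.
have gr := @CR_graded R; have [nD nZ _ _] := gr.
split=> [|a x y].
  rewrite inE => n e e0; exists [::] => //.
  by rewrite /combination big_nil subr0 (graded0 gr).
move=> /set_mem xA /set_mem yA; apply/mem_set => n e e0.
have a0 : 0 < `|a| + 1 by rewrite ltr_wpDl.
have [|K AK xK] := xA n (e / 2 / (`|a| + 1)); first by rewrite divr_gt0// divr_gt0.
have [|L AL yL] := yA n (e / 2); first by rewrite divr_gt0.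
exists ([seq (a * c.1, c.2) | c <- K] ++ L).
  by move=> c; rewrite mem_cat => /orP[/mapP[d dK ->]|cL]; [exact: AK d dK|exact: AL c cL].
have -> : a *: x + y - combination ([seq (a * c.1, c.2) | c <- K] ++ L) =
    a *: (x - combination K) + (y - combination L).
  rewrite /combination big_cat big_map /= scalerBr scaler_sumr opprD addrACA.
  by congr (_ - _ + _); apply: eq_bigr => c _; rewrite scalerA.
apply: le_lt_trans (nD _ _ _) _; rewrite nZ [ltRHS]splitr ltr_leD ?ltW//.
move: xK; rewrite ltr_pdivlMr// => xK.
have := graded_ge0 gr n (x - combination K); nra.
Qed.

Lemma closed_span_closed : closed closed_span.
Proof.
have gr := @CR_graded R; have [nD _ _ pn] := gr.
move=> x clx n e e0.
have [y [yA /= yx]] : closed_span `&` [set y | CR_norm n (y - x) < e / 2] !=set0.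
  by apply: clx; apply/pn; exists n, (e / 2) => //; rewrite divr_gt0.
have [|L AL yL] := yA n (e / 2); first by rewrite divr_gt0.
exists L => //.
have -> : x - combination L = - (y - x) + (y - combination L).
  by rewrite opprB addrA subrK.
apply: le_lt_trans (nD _ _ _) _; rewrite (gradedN gr).
by rewrite [ltRHS]splitr ltrD.
Qed.

Definition koethe : SF R :=
  @MkSF R (LSubspace closed_span_submod) closed_span_closed.

(** True for combinations, and both sides are continuous for the seminorms. *)
Lemma coef_sum_le n G x : uniq G -> closed_span x ->
  \sum_(s <- G) weight s n%:R * `|coef s x| <= CR_norm n.+1 x.
Proof.
move=> uG xA; have gr := @CR_graded R; have [nD _ _ pn] := gr.
apply/ler_addgt0Pr => d d0.
pose M := 1 + \sum_(s <- G) weight s n%:R.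
have M0 : 0 < M by rewrite ltr_wpDr// sumr_ge0// => s _; rewrite ltW// weight_gt0.
have M1 : 0 < M + 1 by rewrite addrC ltr_wpDl// ltW.
have [|L AL xL] := xA n.+1 (d / (M + 1)); first exact: divr_gt0.
set y := combination L in xL.
pose H := undup (G ++ map snd L).
have yH : partial_sum H y = y.
  apply: partial_sum_combination; first exact: undup_uniq.
  by move=> s sL; rewrite mem_undup mem_cat sL orbT.
have le1 : \sum_(s <- G) weight s n%:R * `|coef s y| <= CR_norm n.+1 y.
  rewrite -[in leRHS]yH; apply: le_trans (le_basis_combination n H (coef^~ y)).
  have pG : perm_eq [seq s <- H | s \in G] G.
    apply: uniq_perm; [by rewrite filter_uniq ?undup_uniq|by []|move=> s].
    by rewrite mem_filter mem_undup mem_cat andb_orr andbb; case: (s \in G).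
  rewrite -(perm_big _ pG) big_filter /= [leRHS](bigID (mem G)) /= lerDl sumr_ge0// => s _.
  by rewrite mulr_ge0// ltW// weight_gt0.
have le2 : \sum_(s <- G) weight s n%:R * `|coef s x| <=
    \sum_(s <- G) weight s n%:R * `|coef s y| + M * CR_norm n.+1 (x - y).
  apply: (@le_trans _ _ (\sum_(s <- G) (weight s n%:R * `|coef s y| +
      weight s n%:R * CR_norm n.+1 (x - y)))).
    apply: ler_sum => s _; rewrite -mulrDr ler_wpM2l ?(ltW (weight_gt0 _ _))//.
    have -> : coef s x = coef s y + coef s (x - y) by rewrite coefB addrC subrK.
    apply: le_trans (ler_normD _ _) _; rewrite lerD2l.
    by apply: le_trans (coef_le _ _) _; exact: (graded_le gr).
  rewrite big_split /= lerD2l -mulr_suml ler_wpM2r ?(graded_ge0 gr)//.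
  by rewrite lerDr.
apply: le_trans le2 _; apply: (@le_trans _ _ (CR_norm n.+1 y + M * CR_norm n.+1 (x - y))).
  by rewrite lerD2r.
have : CR_norm n.+1 y <= CR_norm n.+1 x + CR_norm n.+1 (x - y).
  by rewrite -[in leLHS](subKr x y) -(gradedN gr _ (x - y)); exact: nD.
move: xL; rewrite ltr_pdivlMr// => xL.
have := graded_ge0 gr n.+1 (x - y); lra.
Qed.

Lemma partial_sum_le n G x : uniq G -> closed_span x ->
  CR_norm n (partial_sum G x) <= CR_norm n.+1 x.
Proof.
move=> uG xA; apply: le_trans (basis_combination_le n G (coef^~ x)) _.
exact: coef_sum_le.
Qed.

Lemma closed_spanB x y : closed_span x -> closed_span y -> closed_span (x - y).
Proof.
move=> xA yA; have [_ /(_ (-1) y x (mem_set yA) (mem_set xA)) /set_mem] :=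
  closed_span_submod.
by rewrite scaleN1r addrC.
Qed.

(** The truncations are equicontinuous and fix any given combination as soon
    as they contain its support. *)
Lemma partial_sum_cvg n x (e : R) : closed_span x -> 0 < e ->
  exists2 F, uniq F /\ (forall s, s \in F -> A s) & forall G, uniq G ->
    {subset F <= G} -> CR_norm n (x - partial_sum G x) <= e.
Proof.
move=> xA e0; have gr := @CR_graded R; have [nD _ _ pn] := gr.
have [|L AL xL] := xA n.+1 (e / 2); first by rewrite divr_gt0.
exists (undup (map snd L)).
  split=> [|s]; first exact: undup_uniq.
  by rewrite mem_undup => /mapP[c cL ->]; exact: AL.
move=> G uG LG; set y := combination L in xL.
have yG : partial_sum G y = y.
  by apply: partial_sum_combination => // s sL; apply: LG; rewrite mem_undup.
have -> : x - partial_sum G x = (x - y) - partial_sum G (x - y).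
  by rewrite partial_sumB yG opprB addrA subrK.
apply: le_trans (nD _ _ _) _; rewrite (gradedN gr).
have xyA : closed_span (x - y).
  by apply: closed_spanB xA _; exact: combination_closed_span.
have := partial_sum_le n uG xyA.
have := graded_le gr (x - y) (leqnSn n); lra.
Qed.

End spanned_subspace.

End koethe.

(** * Well-founded trees *)

Definition tree (A : set (seq nat)) := forall s n, A s -> A (take n s).
Definition branch (A : set (seq nat)) (b : nat -> nat) := forall n, A (mkseq b n).

(** König's lemma: since entries are bounded at each place, a sequence extended by
    infinitely many elements of [I] has a one-term extension with the same
    property. *)
Lemma koenig (A I : set (seq nat)) : tree A -> I `<=` A ->
  (forall j, exists M, forall s, I s -> (nth 0 s j <= M)%N) ->
  ~ finite_set I -> exists b, branch A b.
Proof.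
move=> tA IA bI infI.
pose above s := [set t | I t /\ take (size s) t = s].
have step s : exists k, infinite_set (above s) -> infinite_set (above (rcons s k)).
  have [M MI] := bI (size s).
  apply: contrapT => nk.
  have {}nk k : infinite_set (above s) /\ finite_set (above (rcons s k)).
    split.
      by apply: contrapT => fs; apply: nk; exists 0%N => /fs.
    by apply: contrapT => fs; apply: nk; exists k.
  have [inf_s _] := nk 0%N; apply: inf_s.
  apply: (@sub_finite_set _ _ ([set s] `|` \bigcup_(k in `I_M.+1) above (rcons s k))).
    move=> t [It ts]; have [st|ts'] := ltnP (size s) (size t); last first.
      by left; rewrite /= -ts take_oversize.
    right; exists (nth 0%N t (size s)); first by rewrite /= ltnS MI.
    by split=> //; rewrite size_rcons (take_nth 0%N)// ts.
  rewrite finite_setU; split; first exact: finite_set1.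
  by apply: bigcup_finite; [exact: finite_II|move=> k _; exact: (nk k).2].
have [b bP] := choice step.
pose x := fix x n := if n is n'.+1 then rcons (x n') (b (x n')) else [::].
have infx n : infinite_set (above (x n)).
  elim: n => [|n IH]; last exact: bP.
  apply: contra_not infI; apply: sub_finite_set => t It.
  by split => //; rewrite take0.
exists (b \o x) => n.
have -> : mkseq (b \o x) n = x n.
  by elim: n => [//|n IH]; rewrite mkseqS IH.
have /infinite_setN0[t [/IA At <-]] := infx n; exact: tA.
Qed.

Lemma geometric_le (R : realType) (e : R) N : 0 < e -> \sum_(m < N) e / 2 ^+ m.+1 <= e.
Proof.
move=> e0; suff -> : \sum_(m < N) e / 2 ^+ m.+1 = e - e / 2 ^+ N.
  by rewrite gerBl divr_ge0 ?exprn_ge0// ltW.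
elim: N => [|N IH]; first by rewrite big_ord0 expr0 divr1 subrr.
rewrite big_ord_recr /= IH exprS; field.
by rewrite expf_neq0.
Qed.

Section koethe_dual.
Variables (R : realType) (A : set (seq nat)) (X : lsubspace (CR R)).
Hypothesis XE : forall x, (X : set (CR R)) x <-> closed_span A x.
Local Notation E := (space_of X).
Implicit Types (x z : E) (y : strong_dual E) (s : seq nat) (F : seq (seq nat)).

Lemma space_graded : graded (fun n (x : E) => CR_norm n (val x)).
Proof. exact/graded_subspace/CR_graded. Qed.

Lemma space_closed_span (x : E) : closed_span A (val x).
Proof. by apply/XE; exact: set_mem (proj2_sig x). Qed.

Definition space_elt (x : CR R) (xA : closed_span A x) : E :=
  exist _ x (mem_set ((XE x).2 xA)).

Lemma eval_linear (t : R) : linear ((fun x => cfun (val x) t) : E -> R^o).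
Proof. by move=> a x z; rewrite val_comb. Qed.

Lemma eval_continuous (t : R) : continuous ((fun x => cfun (val x) t) : E -> R^o).
Proof.
have tn x : `|cfun (val x) t| <= 1 * CR_norm (Num.truncn `|t|).+1 (val x).
  by rewrite mul1r; apply: le_CR_norm; exact/ltW/truncnS_gt.
exact: (graded_dual_continuous space_graded (@eval_linear t) tn).
Qed.

Definition eval_dual (t : R) : strong_dual E :=
  mk_dual (eval_linear t) (@eval_continuous t).

Lemma coef_linear s : linear ((fun x => coef s (val x)) : E -> R^o).
Proof. by move=> a x z; rewrite val_comb coefD coefZ. Qed.

Lemma coef_continuous s : continuous ((fun x => coef s (val x)) : E -> R^o).
Proof.
have sn x : `|coef s (val x)| <= 1 * CR_norm 1 (val x).
  by rewrite mul1r; exact: coef_le.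
exact: (graded_dual_continuous space_graded (@coef_linear s) sn).
Qed.

Definition coef_dual s : strong_dual E :=
  mk_dual (coef_linear s) (@coef_continuous s).

Definition kbasis s : E :=
  if pselect (A s) is left As then space_elt (@basis_closed_span R A s As) else 0.

Lemma val_kbasis s : A s -> val (kbasis s) = basis R s.
Proof. by move=> As; rewrite /kbasis; case: pselect. Qed.

Definition in_tree F := forall s, s \in F -> A s.

Definition truncation F x : E := \sum_(s <- F) coef s (val x) *: kbasis s.

Lemma val_truncation F x : in_tree F -> val (truncation F x) = partial_sum F (val x).
Proof.
move=> FA; rewrite val_sum big_seq [RHS]big_seq; apply: eq_bigr => s sF.
by rewrite val_scale val_kbasis//; exact: FA.
Qed.

Lemma norm_bounded (B : set E) : tvs_bounded B -> exists M : nat -> R,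
  forall n, 0 < M n /\ forall x, B x -> CR_norm n (val x) <= M n.
Proof.
move=> /(graded_boundedP space_graded) bB.
have /choice[M MB] n : exists M, forall x, B x -> CR_norm n (val x) <= M := bB n.
exists (fun n => `|M n| + 1) => n; split; first by rewrite ltr_wpDl.
by move=> x /MB /le_trans; apply; apply: le_trans (ler_norm _) _; rewrite lerDl.
Qed.

Section well_founded.
Hypotheses (tA : tree A) (wfA : forall b, ~ branch A b).

(** Bounded sets have uniformly small tails.  Fix positive numbers [eta m].  If
    [eta m * weight s m <= weight s n] for all [m], then every entry of [s] is
    bounded in terms of its place, so by König's lemma this happens for finitely
    many [s] only.  For any other [s] in [A] the weight at level [n] is dominated by
    some [eta m] times the weight at level [m], and with [eta m] of the order of
    [e / 2 ^+ m] divided by the bound of the set at that level the sum of the tail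
    is at most [e]. *)
Lemma uniform_tail (B : set E) (n : nat) (e : R) : tvs_bounded B -> 0 < e ->
  exists2 F, uniq F /\ in_tree F & forall G, uniq G -> in_tree G ->
    (forall s, s \in G -> s \notin F) ->
    forall x, B x -> \sum_(s <- G) weight s n%:R * `|coef s (val x)| <= e.
Proof.
move=> bB e0; have [M MP] := norm_bounded bB.
(* The index [m.+1] of the bound comes from the loss of one level when
   coefficients are estimated by sup norms. *)
pose eta m : R := e / 2 ^+ m.+1 / M m.+1.
have eta0 m : 0 < eta m by rewrite !divr_gt0 ?exprn_gt0//; have [] := MP m.+1.
pose I := [set s | A s /\ forall m, eta m * weight s m%:R <= weight s n%:R].
have finI : finite_set I.
  apply: contrapT => infI.
  have [||b /wfA//] := @koenig A I tA _ _ infI; first by move=> s [].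
  move=> j; pose m := (n + j + 2)%N; exists (Num.truncn (eta m)^-1).+1 => s [As sI].
  have wn : 0 < weight s (n%:R : R) := weight_gt0 _ _.
  have : eta m * (weight s n%:R * (1 + (nth 0%N s j)%:R)) <= weight s n%:R.
    apply: le_trans (sI m); rewrite ler_pM2l//.
    apply: (@le_trans _ _ (weight s n%:R * expR (nth 0%N s j)%:R)).
      by rewrite ler_pM2l//; exact: expR_ge1Dx.
    by rewrite /weight -expRD ler_expR exponent_gap.
  rewrite mulrCA ger_pMr// -ler_pdivlMl// mulr1 => le.
  rewrite -(ler_nat R); apply: le_trans (ltW (truncnS_gt _)).
  by apply: le_trans le; rewrite lerDr.
have [F0 F0I] : exists F0 : seq (seq nat), I = [set` F0] by apply/finite_seqP.
exists (undup F0).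
  split=> [|s]; first exact: undup_uniq.
  rewrite mem_undup => sF; have : I s by rewrite F0I.
  by case.
move=> G uG GA GF x Bx.
have /choice[ms msP] s : exists m, s \in G -> weight s n%:R < eta m * weight s m%:R.
  have [sG|] := boolP (s \in G); last by exists 0%N.
  apply: contrapT => nm.
  have : I s.
    split; first exact: GA.
    by move=> m; rewrite leNgt; apply/negP => lt; apply: nm; exists m.
  by rewrite F0I /= => sF; have := GF s sG; rewrite mem_undup sF.
pose N := (\max_(s <- G) ms s).+1.
apply: (@le_trans _ _ (\sum_(s <- G) \sum_(m < N)
    eta m * (weight s m%:R * `|coef s (val x)|))).
  rewrite big_seq [leRHS]big_seq; apply: ler_sum => s sG.
  have mN : (ms s < N)%N by rewrite ltnS; exact: leq_bigmax_seq.
  rewrite (bigD1 (Ordinal mN))//=.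
  apply: (@le_trans _ _ (eta (ms s) * (weight s (ms s)%:R * `|coef s (val x)|))).
    by rewrite mulrA ler_wpM2r// ltW// msP.
  rewrite lerDl sumr_ge0// => i _; rewrite mulr_ge0 ?(ltW (eta0 _))//.
  by rewrite mulr_ge0// ltW// weight_gt0.
rewrite exchange_big /=; apply: le_trans (geometric_le N e0).
apply: ler_sum => m _; rewrite -mulr_sumr.
have [M0 MB] := MP m.+1; rewrite /eta mulrAC ler_pdivrMr//.
rewrite ler_wpM2l ?divr_ge0 ?exprn_ge0 ?(ltW e0)//.
apply: le_trans (MB x Bx); apply: coef_sum_le uG _; exact: space_closed_span.
Qed.

Lemma uniform_truncation (B : set E) (n : nat) (e : R) : tvs_bounded B -> 0 < e ->
  exists2 F, in_tree F & forall x, B x ->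
    CR_norm n (val x - partial_sum F (val x)) <= e.
Proof.
move=> bB e0; have [F [uF FA] FP] := uniform_tail n bB e0.
exists F => // x Bx; apply/ler_addgt0Pl => d d0.
have [H [uH HA] HP] := partial_sum_cvg n (space_closed_span x) d0.
pose G := undup (F ++ H).
have uG : uniq G by exact: undup_uniq.
have GA : in_tree G.
  by move=> s; rewrite mem_undup mem_cat => /orP[/FA|/HA].
have GE : partial_sum G (val x) = partial_sum F (val x) +
    partial_sum [seq s <- G | s \notin F] (val x).
  rewrite /partial_sum (bigID (mem F)) /= big_filter; congr (_ + _).
  rewrite -big_filter; apply: perm_big; apply: uniq_perm => //.
    by rewrite filter_uniq.
  by move=> s; rewrite mem_filter mem_undup mem_cat; case: (s \in F).
have -> : val x - partial_sum F (val x) = (val x - partial_sum G (val x)) +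
    partial_sum [seq s <- G | s \notin F] (val x).
  by rewrite GE opprD addrA subrK.
have [nD _ _ _] := @CR_graded R; apply: le_trans (nD _ _ _) _; apply: lerD.
  by apply: HP => // s sH; rewrite mem_undup mem_cat sH orbT.
apply: le_trans (basis_combination_le n _ (fun s => coef s (val x))) _.
apply: FP => //; first by rewrite filter_uniq.
  by move=> s; rewrite mem_filter => /andP[_ /GA].
by move=> s; rewrite mem_filter => /andP[].
Qed.

Lemma functional_truncation y F x : in_tree F ->
  y x - \sum_(s <- F) y (kbasis s) * coef_dual s x = y (x - truncation F x).
Proof.
move=> FA; rewrite dualB dual_sum; congr (_ - _); apply: eq_bigr => s _.
by rewrite dualZ mulrC.
Qed.

(** By the uniform smallness of tails, a functional is approximated on a
    bounded set by a finite combination of coefficients, which in turn can be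
    taken rational. *)
Lemma koethe_separable_dual : has_separable_dual E.
Proof.
pose comb (L : seq (rat * seq nat)) : strong_dual E :=
  \sum_(c <- L) ratr c.1 *: coef_dual c.2.
exists (range comb); first exact: sub_countable (card_image_le _ _) (countableP _).
move=> O O0 oO; have [y Oy] : exists y : strong_dual E, O y by [].
have /dual_nbhsP[B [bB [e e0 BO]]] : nbhs y O by exact: open_nbhs_nbhs.
have [n [C C0 yC]] := graded_dual_bound space_graded y.
have [M MP] := norm_bounded bB; have [M0 MB] := MP 1%N.
have e2 : 0 < e / 2 by rewrite divr_gt0.
have [F FA FP] := uniform_truncation n bB (divr_gt0 e2 C0).
pose d := e / 2 / ((size F)%:R + 1) / M 1%N.
have d0 : 0 < d by rewrite divr_gt0// divr_gt0// ltr_wpDl.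
have /choice[q qP] s : exists q : rat, `|y (kbasis s) - ratr q| < d.
  have [|q] := @rat_in_itvoo R (y (kbasis s) - d) (y (kbasis s) + d); first by lra.
  rewrite in_itv /= => /andP[q1 q2]; exists q; rewrite ltr_norml; apply/andP; split; lra.
exists (comb [seq (q s, s) | s <- F]); split; last by exists [seq (q s, s) | s <- F].
apply: BO => x Bx; rewrite /comb big_map sum_dualE distrC.
under eq_bigr do rewrite scale_dualE.
have -> : y x - \sum_(s <- F) ratr (q s) * coef_dual s x =
    y (x - truncation F x) +
    \sum_(s <- F) (y (kbasis s) - ratr (q s)) * coef_dual s x.
  rewrite -functional_truncation// -addrA; congr (_ + _).
  rewrite -sumrN -sumrN -big_split /=; apply: eq_bigr => s _.
  by rewrite mulrBl addKr.
apply: le_lt_trans (ler_normD _ _) _; rewrite [ltRHS]splitr ler_ltD//.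
  apply: le_trans (yC _) _; rewrite -ler_pdivlMl// mulrC.
  by rewrite val_sub val_truncation// FP.
apply: le_lt_trans (ler_norm_sum _ _ _) _.
rewrite (big_nth [::]) big_mkord; apply: le_lt_trans _ (sum_share_lt (size F) e2).
apply: ler_sum => i _; rewrite normrM.
have -> : e / 2 / ((size F)%:R + 1) = d * M 1%N by rewrite /d divfK// gt_eqF.
by rewrite ler_pM// ?(ltW (qP _))//; apply: le_trans (coef_le _ _) (MB x Bx).
Qed.

(** Evaluations at points are continuous functionals. *)
Lemma evaluation_injective : injective (evaluation space_graded).
Proof.
move=> x z xz; apply: val_inj; apply: cfunP => t.
by have : evaluation space_graded x (eval_dual t) = cfun (val x) t := erefl;
   rewrite xz => <-.
Qed.

(** The only candidate is the function sending [t] to the value of [Phi] at the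
    evaluation at [t].  By [bidual_bound], [Phi] respects approximations that are
    uniform on a bounded set; so by the uniform smallness of tails this function
    is, uniformly on segments, a limit of combinations of basis vectors, and
    [Phi] agrees with it on every functional. *)
Lemma evaluation_surjective (Phi : strong_dual (strong_dual E)) :
  exists x, evaluation space_graded x = Phi.
Proof.
have [B [bB [C C0 PhiC]]] := bidual_bound Phi.
pose f t : R := Phi (eval_dual t).
pose fF F : CR R := \sum_(s <- F) Phi (coef_dual s) *: basis R s.
have near n (e : R) F t : 0 < e -> in_tree F -> (forall z, B z ->
    CR_norm n (val z - partial_sum F (val z)) <= e) -> `|t| <= n%:R ->
    `|f t - cfun (fF F) t| <= C * e.
  move=> e0 FA FP tn.
  have -> : f t - cfun (fF F) t =
      Phi (eval_dual t - \sum_(s <- F) cfun (basis R s) t *: coef_dual s).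
    rewrite dualB dual_sum cfun_sum; congr (_ - _); apply: eq_bigr => s _.
    by rewrite dualZ mulrC.
  apply: PhiC => // z Bz; rewrite sub_dualE sum_dualE.
  have -> : eval_dual t z - \sum_(s <- F) (cfun (basis R s) t *: coef_dual s : strong_dual E) z =
      cfun (val z - partial_sum F (val z)) t.
    rewrite cfunB cfun_sum; congr (_ - _); apply: eq_bigr => s _.
    by rewrite scale_dualE mulrC.
  exact: le_trans (le_CR_norm _ tn) (FP z Bz).
have cf : continuous (f : R -> R^o).
  move=> t0 W; rewrite nbhs_ballP => -[e /= e0 eW].
  pose n := (Num.truncn (`|t0| + 1)).+1.
  have e4 : 0 < e / 4 / C by rewrite !divr_gt0.
  have [F FA FP] := uniform_truncation n bB e4.
  have Ce : C * (e / 4 / C) = e / 4 by field; rewrite gt_eqF.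
  have nF : nbhs t0 [set t | `|t - t0| < 1 /\
      `|cfun (fF F) t - cfun (fF F) t0| < e / 4].
    apply: filterI.
      by apply/nbhs_normP; exists 1 => //= t /=; rewrite distrC.
    have nb : nbhs (cfun (fF F) t0 : R^o)
        [set r | `|r - cfun (fF F) t0| < e / 4].
      apply/nbhs_normP; exists (e / 4); first by rewrite /= divr_gt0.
      by move=> r /=; rewrite distrC.
    exact: (@cfun_continuous R (fF F) t0 _ nb).
  apply: filterS nF => t [/= tt0 tF]; apply: eW; rewrite -ball_normE /= distrC.
  have t0n : `|t0| <= n%:R.
    by apply: le_trans (ltW (truncnS_gt _)); rewrite lerDl.
  have tn : `|t| <= n%:R.
    apply: le_trans (ltW (truncnS_gt _)); rewrite -(subrK t0 t) addrC.
    by apply: le_trans (ler_normD _ _) _; rewrite lerD2l ltW.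
  have := near n _ F t e4 FA FP tn; have := near n _ F t0 e4 FA FP t0n.
  rewrite Ce => h1 h2.
  have -> : f t - f t0 = (f t - cfun (fF F) t) + (cfun (fF F) t - cfun (fF F) t0)
     - (f t0 - cfun (fF F) t0) by ring.
  apply: le_lt_trans (ler_normB _ _) _.
  apply: le_lt_trans (lerD (ler_normD _ _) (lexx _)) _; lra.
pose x0 := mk_cfun cf.
have x0A : closed_span A x0.
  move=> n e e0; have e2 : 0 < e / 2 / C by rewrite !divr_gt0.
  have [F FA FP] := uniform_truncation n bB e2.
  exists [seq (Phi (coef_dual s), s) | s <- F].
    by move=> c /mapP[s sF ->]; exact: FA s sF.
  apply: (@le_lt_trans _ _ (e / 2)); last by lra.
  apply: sup_norm_le => t tn; rewrite -/(cfun _) cfunB /combination big_map.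
  have := near n _ F t e2 FA FP tn.
  by have -> : C * (e / 2 / C) = e / 2 by field; rewrite gt_eqF.
exists (space_elt x0A); apply: dual_eqP => y.
have -> : evaluation space_graded (space_elt x0A) y = (y : strong_dual E) (space_elt x0A) by [].
apply/eqP; rewrite -subr_eq0 -normr_le0; apply/ler_addgt0Pl => e e0; rewrite addr0.
have [n [C' C'0 yC]] := graded_dual_bound space_graded y.
pose d := e / (2 * C * C').
have d0 : 0 < d by rewrite divr_gt0// !mulr_gt0.
have [F FA FP] := uniform_truncation n bB d0.
pose xF : E := \sum_(s <- F) Phi (coef_dual s) *: kbasis s.
pose yF : strong_dual E := \sum_(s <- F) (y : strong_dual E) (kbasis s) *: coef_dual s.
have xyF : (y : strong_dual E) xF = Phi yF.
  by rewrite !dual_sum; apply: eq_bigr => s _; rewrite !dualZ mulrC.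
have -> : (y : strong_dual E) (space_elt x0A) - Phi y =
    (y : strong_dual E) (space_elt x0A - xF) - Phi (y - yF).
  by rewrite !dualB xyF; ring.
apply: le_trans (ler_normB _ _) _.
have -> : e = C' * (C * d) + C * (C' * d) by rewrite /d; field; rewrite !gt_eqF.
apply: lerD.
  apply: le_trans (yC _) _; rewrite ler_pM2l//; apply: sup_norm_le => t tn.
  rewrite -/(cfun _) val_sub.
  have -> : val xF = fF F.
    rewrite val_sum /fF big_seq [RHS]big_seq; apply: eq_bigr => s sF.
    by rewrite val_scale val_kbasis//; exact: FA.
  exact: near d0 FA FP tn.
apply: PhiC => [|z Bz]; first exact: mulr_gt0.
rewrite sub_dualE sum_dualE.
under eq_bigr do rewrite scale_dualE.
rewrite functional_truncation//; apply: le_trans (yC _) _; rewrite ler_pM2l//.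
by rewrite val_sub val_truncation// FP.
Qed.

(** The inverse of the evaluation map is continuous because a sup norm is a
    supremum over a bounded set of functionals, the evaluations at the points of
    a segment. *)
Lemma koethe_reflexive : is_reflexive E.
Proof.
pose J := evaluation space_graded.
have [K KJ] := choice evaluation_surjective.
exists J, K; split => //.
- by move=> x; apply: evaluation_injective; rewrite KJ.
- exact: continuous_evaluation.
have [_ _ _ pn] := space_graded.
move=> Phi W /pn[n [e e0 eW]].
apply/dual_nbhsP; exists [set eval_dual t | t in [set t | `|t| <= n%:R]]; split.
  apply/dual_boundedP => B bB; have [M MP] := norm_bounded bB.
  exists (M n) => _ x [t tn <-] Bx; have [_ MB] := MP n.
  exact: le_trans (le_CR_norm _ tn) (MB x Bx).
have evK Psi t : cfun (val (K Psi)) t = Psi (eval_dual t).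
  by rewrite -[in RHS](KJ Psi).
exists (e / 2); first exact: divr_gt0.
move=> Psi PsiPhi; suff le : CR_norm n (val (K Psi - K Phi)) <= e / 2.
  by apply: eW; apply: le_lt_trans le _; lra.
rewrite val_sub; apply: sup_norm_le => t tn; rewrite -/(cfun _).
by rewrite cfunB !evK; apply/ltW/PsiPhi; exists t.
Qed.

End well_founded.
End koethe_dual.

(** * Non-normability, and trees with a branch *)

Section not_normable.
Variables (R : realType) (A : set (seq nat)) (X : lsubspace (CR R)).
Hypothesis XE : forall x, (X : set (CR R)) x <-> closed_span A x.
Local Notation E := (space_of X).

Lemma weight_singleton_le n k : weight [:: k] n%:R <= expR (k%:R * n%:R) :> R.
Proof.
rewrite ler_expR /exponent /= big_ord1 /= ler_wpM2l// ge_max ler0n /= subr0.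
by rewrite ger0_norm// gerBl.
Qed.

Lemma le_weight_singleton n k : expR (k%:R * n%:R) <= weight [:: k] n.+1%:R :> R.
Proof.
rewrite ler_expR /exponent /= big_ord1 /= ler_wpM2l// le_max subr0.
by rewrite ger0_norm// -natr1 addrK lexx orbT.
Qed.

(** A norm would make some seminorm dominate all the others up to constants, but
    the quotient of distant seminorms is already unbounded on the basis vectors
    of the sequences of length one. *)
Lemma koethe_not_normable : (forall k, A [:: k]) -> ~ normable E.
Proof.
move=> A1 [N [ND NZ N0 Nn]]; have gr := space_graded X.
have [n [e e0 en]] : exists n, exists2 e : R, 0 < e &
    [set y : E | CR_norm n (val (y - 0)) < e] `<=` [set y | N (y - 0) < 1].
  by have [_ _ _ pn] := gr; apply/pn/Nn; exists 1.
have [d d0 dn] : exists2 d : R, 0 < d &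
    [set y : E | N (y - 0) < d] `<=` [set y | CR_norm (n.+3) (val (y - 0)) < 1].
  by apply/Nn; have [_ _ _ pn] := gr; apply/pn; exists n.+3, 1.
have key k : d * (e / 2) * expR k%:R < 1.
  pose b : E := kbasis XE [:: k].
  (* Scaled by [c], the basis vector lies in the ball contained in the unit
     ball of the norm. *)
  pose c := e / 2 * expR (- (k%:R * n%:R)).
  have c0 : 0 < c by rewrite mulr_gt0 ?expR_gt0// divr_gt0.
  have vb : val b = \sum_(s <- [:: [:: k]]) 1 *: basis R s.
    by rewrite big_seq1 scale1r /b val_kbasis.
  have bn : CR_norm n (val b) <= expR (k%:R * n%:R).
    rewrite vb; apply: le_trans (basis_combination_le n [:: [:: k]] (fun=> 1)) _.
    by rewrite big_seq1 normr1 mulr1 weight_singleton_le.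
  have bn3 : expR (k%:R * n.+1%:R) <= CR_norm n.+3 (val b).
    rewrite vb; apply: le_trans (le_basis_combination n.+2 [:: [:: k]] (fun=> 1)).
    by rewrite big_seq1 normr1 mulr1 le_weight_singleton.
  have cb : N (c *: b - 0) < 1.
    apply: en; rewrite /= subr0; have [_ pZ _ _] := gr.
    rewrite [ltLHS]pZ gtr0_norm//; apply: (@le_lt_trans _ _ (c * expR (k%:R * n%:R))).
      by rewrite ler_pM2l.
    by rewrite /c -mulrA -expRD addNr expR0; lra.
  have : CR_norm n.+3 (val (d *: (c *: b) - 0)) < 1.
    apply: dn; rewrite /= subr0 NZ gtr0_norm//.
    by rewrite subr0 in cb; rewrite gtr_pMr.
  rewrite subr0 scalerA; have [_ pZ _ _] := gr; rewrite [ltLHS]pZ.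
  rewrite gtr0_norm ?mulr_gt0//; apply: le_lt_trans.
  apply: (@le_trans _ _ (d * c * expR (k%:R * n.+1%:R))); last first.
    by rewrite ler_pM2l// mulr_gt0.
  rewrite /c -!mulrA -expRD -[n.+1%:R]natr1.
  by have -> : - (k%:R * n%:R) + k%:R * (n%:R + 1) = k%:R :> R by ring.
have de0 : 0 < d * (e / 2) by rewrite mulr_gt0// divr_gt0.
have := key (Num.truncn (d * (e / 2))^-1).+1.
rewrite -ltr_pdivlMl// mulr1; apply/negP; rewrite -leNgt.
apply: le_trans (ltW (truncnS_gt _)) _; apply: le_trans (expR_ge1Dx _).
by rewrite lerDr.
Qed.

End not_normable.

Section ill_founded.
Variables (R : realType) (A : set (seq nat)) (X : lsubspace (CR R)).
Hypothesis XE : forall x, (X : set (CR R)) x <-> closed_span A x.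
Local Notation E := (space_of X).
Variable b : nat -> nat.
Hypothesis Ab : branch A b.

Definition branch_vector k : E := kbasis XE (mkseq b k).

(** Only the first [n] entries contribute at level [n]. *)
Lemma exponent_branch_le n k :
  exponent (mkseq b k) n%:R <= \sum_(j < n) (b j)%:R * n%:R :> R.
Proof.
pose g (j : nat) : R := (b j)%:R * Num.max 0 (`|n%:R| - 1 - j%:R).
have g0 j : 0 <= g j by rewrite mulr_ge0// le_max lexx.
have gn j : (n <= j)%N -> g j = 0.
  move=> nj; rewrite /g max_l ?mulr0// ger0_norm//.
  by have : n%:R <= j%:R :> R by [rewrite ler_nat]; lra.
have -> : exponent (mkseq b k) n%:R = \sum_(j < k) g j.
  by rewrite /exponent size_mkseq; apply: eq_bigr => j _; rewrite nth_mkseq.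
apply: (@le_trans _ _ (\sum_(j < n) g j)).
  have [kn|nk] := leqP k n.
    rewrite -(subnKC kn) big_split_ord /= lerDl sumr_ge0//.
  rewrite -(subnKC (ltnW nk)) big_split_ord /= [X in _ + X]big1 ?addr0//.
  by move=> i _; rewrite gn// leq_addr.
apply: ler_sum => j _; rewrite ler_wpM2l// ge_max ler0n /= ger0_norm//.
by have : 0 <= (j : nat)%:R :> R by []; lra.
Qed.

Lemma branch_bounded : tvs_bounded (range branch_vector).
Proof.
apply/(graded_boundedP (space_graded X)) => n.
exists (expR (\sum_(j < n) (b j)%:R * n%:R)) => _ [k _ <-].
have -> : val (branch_vector k) = \sum_(s <- [:: mkseq b k]) 1 *: basis R s.
  by rewrite big_seq1 scale1r /branch_vector val_kbasis.
apply: le_trans (basis_combination_le n [:: mkseq b k] (fun=> 1)) _.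
by rewrite big_seq1 normr1 mulr1 ler_expR exponent_branch_le.
Qed.

Lemma eval_branch_vector eps k :
  eval_dual X (sign_point R eps) (branch_vector k) = sgn_of R (eps (pickle (mkseq b k))).
Proof.
rewrite -basis_sign_point -[LHS]/(cfun (val (branch_vector k)) _).
by rewrite /branch_vector val_kbasis.
Qed.

(** The vectors of the branch form a bounded set on which evaluations realize
    all patterns of signs.  Given a sequence of functionals, the pattern opposite
    to the sign of its [m]-th term at the [m]-th vector is at distance one or
    more from each of them. *)
Lemma koethe_not_separable_dual : ~ has_separable_dual E.
Proof.
move=> [D cD dD].
have [d Dd] : exists d : nat -> strong_dual E, D `<=` range d.
  exact: (@countable_range (strong_dual E) 0 D cD).
pose eps i := if unpickle i is Some s then
  ~~ (0 < d (size (s : seq nat)) (branch_vector (size s))) else true.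
pose y := eval_dual X (sign_point R eps).
pose V := [set g : strong_dual E | forall x, range branch_vector x -> `|g x - y x| < 1].
have nV : nbhs y V by apply/dual_nbhsP; exists (range branch_vector); split;
  [exact: branch_bounded|exists 1].
have [|g [Vg Dg]] := dD V^° _ (@open_interior _ V); first by exists y.
have [m _ dm] := Dd _ Dg.
have := interior_subset Vg (branch_vector m) (ex_intro2 _ _ m I erefl).
rewrite -dm /y eval_branch_vector /eps pickleK size_mkseq.
by case: (ltP 0 (d m (branch_vector m))) => dm0 /=; rewrite ltr_norml => /andP[]; lra.
Qed.

(** The vectors of the branch being bounded, limits along an ultrafilter of the
    values of functionals on them define an element of the bidual.  If [x]
    represented it, then [x] would take the value one or minus one at every
    point where the signs are eventually constant along the branch.  But an
    approximation of [x] by a finite combination cannot distinguish two points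
    whose sign patterns differ only off its support. *)
Lemma koethe_not_reflexive : ~ is_reflexive E.
Proof.
move=> [J [K [JE JK KJ cJ cK]]].
have [U [UU ooU]] := ultraFilterLemma (F := \oo) _.
have PU : ProperFilter U by exact: ultra_proper.
have limP (y : strong_dual E) : exists l : R, y (branch_vector k) @[k --> U] --> l.
  have [M MP] := dual_bounded_on y branch_bounded.
  have [|l [_ cl]] := @segment_compact R (- M) M (y (branch_vector k) @[k --> U]) _.
    by apply: (@filterE _ U) => k /=; rewrite in_itv /= -ler_norml; apply: MP; exists k.
  exists l => V nV.
  have [//|nVU] := in_ultra_setVsetC ((fun k => y (branch_vector k)) @^-1` V) UU.
  by have [r []] := cl (~` V) V nVU nV.
have /choice[Phi PhiP] := limP.
have uniq_lim (u : nat -> R) (l1 l2 : R) :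
    u k @[k --> U] --> l1 -> u k @[k --> U] --> l2 -> l1 = l2.
  by move=> ul1 ul2; exact: (@norm_cvg_unique R R^o (fmap u U) _ l1 l2 ul1 ul2).
have lPhi : linear (Phi : strong_dual E -> R^o).
  move=> a f g; apply: (uniq_lim _ _ _ (PhiP (a *: f + g))).
  have lim_af : a * (f : strong_dual E) (branch_vector k) @[k --> U] --> a * Phi f.
    by apply: (@cvgMl_tmp R); exact: PhiP.
  exact: (@cvgD R R^o nat U _ _ _ _ _ lim_af (PhiP g)).
have cPhi : continuous (Phi : strong_dual E -> R^o).
  apply: (@bounded_continuous_bidual R E Phi _ 1 lPhi branch_bounded) => y y1.
  have lim_norm : `|y (branch_vector k)| @[k --> U] --> `|Phi y|.
    by apply: (@cvg_norm R R^o); exact: PhiP.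
  have le1 : \forall k \near U, `|y (branch_vector k)| <= 1.
    by apply: (@filterE _ U) => k; apply: y1; exists k.
  exact: (@closed_cvg nat R^o U _ _ [set r : R | r <= 1] (@closed_le R 1) le1 _ lim_norm).
pose x := K (mk_dual lPhi cPhi).
have xP (y : strong_dual E) : y x = Phi y by rewrite -JE KJ.
have signs eps c : (\forall k \near \oo, sgn_of R (eps (pickle (mkseq b k))) = c) ->
    cfun (val x) (sign_point R eps) = c.
  move=> nc; rewrite -[LHS]/(eval_dual X (sign_point R eps) x) xP.
  apply: (uniq_lim _ _ _ (PhiP (eval_dual X (sign_point R eps)))).
  have cU : U [set k | eval_dual X (sign_point R eps) (branch_vector k) = c].
    by apply: ooU; apply: filterS nc => k <-; exact: eval_branch_vector.
  exact: (@cvg_near_cst nat R^o c _ U _ cU).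
have half : 0 < 1 / 2 :> R by rewrite divr_gt0.
have [L AL xL] := space_closed_span XE x 1 half.
pose F := map snd L.
pose eps1 (i : nat) := true.
pose eps2 i := i \in map pickle F.
have x1 : cfun (val x) (sign_point R eps1) = 1 by apply: signs; exists 0%N.
have x2 : cfun (val x) (sign_point R eps2) = -1.
  apply: signs; exists (\max_(s <- F) size s).+1 => // k /= kF.
  rewrite /eps2 mem_map; last exact: pcan_inj pickleK.
  case: (boolP (mkseq b k \in F)) => // bF; have := @leq_bigmax_seq _ F xpredT size (mkseq b k) bF erefl.
  by rewrite size_mkseq leqNgt kF.
have cL : cfun (combination L) (sign_point R eps1) =
    cfun (combination L) (sign_point R eps2).
  rewrite !cfun_sum big_seq [RHS]big_seq; apply: eq_bigr => c cL.
  by rewrite !cfunZ !basis_sign_point /eps2 map_f// map_f.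
have h1 := @le_CR_norm R 1 (val x - combination L) _ (sign_point_norm R eps1).
have h2 := @le_CR_norm R 1 (val x - combination L) _ (sign_point_norm R eps2).
move: (le_lt_trans h1 xL) (le_lt_trans h2 xL).
by rewrite !cfunB x1 x2 cL !ltr_norml => /andP[? ?] /andP[? ?]; lra.
Qed.

End ill_founded.

(** * Analytic sets and the Effros Borel structure *)

Definition agree (T : Type) n (c c' : nat -> T) := forall i, (i < n)%N -> c i = c' i.

Lemma agree_le (T : Type) m n (c c' : nat -> T) :
  (m <= n)%N -> agree n c c' -> agree m c c'.
Proof. by move=> mn cc i im; apply: cc; exact: leq_trans mn. Qed.

Lemma mkseq_agree (T : Type) n (c c' : nat -> T) :
  agree n c c' -> mkseq c n = mkseq c' n.
Proof.
move=> cc; apply/eq_in_map => i; rewrite mem_iota add0n => /andP[_].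
exact: cc.
Qed.

Lemma agree_mkseq (T : eqType) n (c c' : nat -> T) :
  mkseq c n = mkseq c' n -> agree n c c'.
Proof.
by move=> cc i im; have := congr1 (fun s => nth (c i) s i) cc; rewrite !nth_mkseq.
Qed.

(** Closedness in the product of the Cantor and Baire spaces, expressed with
    finite initial segments. *)
Definition closed_rel (F : (nat -> bool) -> (nat -> nat) -> Prop) :=
  forall c b, (forall n, exists c' b', [/\ F c' b', agree n c c' & agree n b b']) ->
    F c b.

Definition analytic (A : set (nat -> bool)) :=
  exists2 F, closed_rel F & forall c, A c <-> exists b, F c b.

Definition clopen_pred (A : set (nat -> bool)) :=
  forall c, exists n, forall c', agree n c c' -> (A c <-> A c').

Lemma clopen_analytic A : clopen_pred A -> analytic A.
Proof.
move=> cA; exists (fun c _ => A c) => [c b cb|c].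
  have [n nA] := cA c; have [c' [b' [Ac' cc' _]]] := cb n.
  exact/(nA c' cc').
by split=> [Ac|[]//]; exists (fun=> 0%N).
Qed.

Lemma clopenC A : clopen_pred A -> clopen_pred (~` A).
Proof.
move=> cA c; have [n nA] := cA c; exists n => c' /nA AA'.
by split; apply: contra_not; rewrite AA'.
Qed.

(** The first entry of the witness chooses the member of the union. *)
Lemma analytic_bigcup (A : nat -> set (nat -> bool)) :
  (forall i, analytic (A i)) -> analytic (\bigcup_i A i).
Proof.
move=> aA.
have /choice[F FP] i : exists F, closed_rel F /\ forall c, A i c <-> exists b, F c b.
  by have [F cF FE] := aA i; exists F.
exists (fun c b => F (b 0%N) c (b \o S)) => [c b cb|c].
  apply: (FP (b 0%N)).1 => n; have [c' [b' [Fb cc bb]]] := cb n.+1.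
  exists c', (b' \o S); split.
  - by rewrite (bb 0%N).
  - exact: agree_le cc.
  - by move=> i i_n; apply: bb.
split=> [[i _ /((FP i).2 c)[b Fb]]|[b Fb]].
  by exists (fun n => if n is n'.+1 then b n' else i).
by exists (b 0%N) => //; apply/(FP _).2; exists (b \o S).
Qed.

(** One sequence encodes witnesses for all members, through the pairing
    [pickle]; the relation stays closed because each of its entries is a single
    entry of the encoding. *)
Lemma analytic_bigcap (A : nat -> set (nat -> bool)) :
  (forall i, analytic (A i)) -> analytic (\bigcap_i A i).
Proof.
move=> aA.
have /choice[F FP] i : exists F, closed_rel F /\ forall c, A i c <-> exists b, F c b.
  by have [F cF FE] := aA i; exists F.
exists (fun c b => forall i, F i c (fun j => b (pickle (i, j)))) => [c b cb i|c].
  apply: (FP i).1 => n.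
  pose N := (n + \max_(j < n) (pickle (i, j : nat)).+1)%N.
  have [c' [b' [Fb cc bb]]] := cb N.
  exists c', (fun j => b' (pickle (i, j))); split => //.
    exact: agree_le (leq_addr _ _) cc.
  move=> j jn; apply: bb; apply: leq_trans (leq_addl _ _).
  exact: (@leq_bigmax _ (fun j : 'I_n => (pickle (i, j : nat)).+1) (Ordinal jn)).
split=> [Ac|[b Fb] i _]; last first.
  by apply/(FP i).2; exists (fun j => b (pickle (i, j))).
have /choice[b bP] i : exists b, F i c b by apply/(FP i).2; exact: Ac.
exists (fun k => if unpickle k is Some (i, j) then b i j else 0%N) => i.
by under eq_fun do rewrite pickleK.
Qed.

Definition bianalytic A := analytic A /\ analytic (~` A).

Lemma bianalytic_bigcup (A : nat -> set (nat -> bool)) :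
  (forall i, bianalytic (A i)) -> bianalytic (\bigcup_i A i).
Proof.
move=> bA; split; first by apply: analytic_bigcup => i; exact: (bA i).1.
by rewrite setC_bigcup; apply: analytic_bigcap => i; exact: (bA i).2.
Qed.

Lemma clopen_bianalytic A : clopen_pred A -> bianalytic A.
Proof. by move=> cA; split; apply: clopen_analytic => //; exact: clopenC. Qed.

(** The easy half of Souslin's theorem: sets that are analytic together with
    their complements form a sigma-algebra. *)
Lemma borel_preimage_bianalytic (T : Type) (G : set_system T)
    (f : (nat -> bool) -> T) :
  (forall S, G S -> bianalytic (f @^-1` S)) ->
  forall S, <<s G >> S -> bianalytic (f @^-1` S).
Proof.
move=> Gf S; apply: (@smallest_sub _ _ _ [set S | bianalytic (f @^-1` S)]) => //.
split=> [|B bB|B bB] /=.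
- by apply: clopen_bianalytic => c; exists 0%N => c' _; rewrite preimage_set0.
- rewrite setTD preimage_setC; split; first exact: bB.2.
  by rewrite setCK; exact: bB.1.
- by rewrite preimage_bigcup; exact: bianalytic_bigcup.
Qed.

(** A point [c] is read as the code of a set of pairs of finite sequences, which
    describes a closed subset of the product of the Cantor and Baire spaces; the
    tree below describes the section of this closed set at the point [c] itself.
    The bound [2 <= n] keeps all the sequences of length one in the tree, so that
    the space attached to it is never normable. *)
Definition diagonal_tree (c : nat -> bool) : set (seq nat) := [set s |
  forall n, (2 <= n <= size s)%N -> c (pickle (mkseq c n, take n s))].

Lemma tree_diagonal_tree c : tree (diagonal_tree c).
Proof.
move=> s m sT n /andP[n2]; rewrite size_take_min leq_min => /andP[nm ns].
by rewrite take_takel//; apply: sT; rewrite n2.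
Qed.

Lemma diagonal_tree1 c k : diagonal_tree c [:: k].
Proof. by move=> n /andP[n2 n1]; have := leq_trans n2 n1. Qed.

Lemma branch_diagonal_tree c b : branch (diagonal_tree c) b <->
  forall n, (2 <= n)%N -> c (pickle (mkseq c n, mkseq b n)).
Proof.
have tk m n : (n <= m)%N -> take n (mkseq b m) = mkseq b n.
  by move=> nm; rewrite /mkseq -map_take take_iota (minn_idPl nm).
split=> [bc n n2|bc m n /andP[n2]]; rewrite ?size_mkseq => *.
  by rewrite -(tk n n)//; apply: bc; rewrite size_mkseq n2 leqnn.
by rewrite tk//; exact: bc.
Qed.

Lemma clopen_diagonal_tree s : clopen_pred [set c | diagonal_tree c s].
Proof.
move=> c; pose code n := pickle (mkseq c n, take n s).
pose N := (size s + \max_(n < (size s).+1) (code n).+1)%N.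
exists N => c' cc'.
suff cE n : (n <= size s)%N -> c (pickle (mkseq c n, take n s)) =
    c' (pickle (mkseq c' n, take n s)).
  by split=> cs n ns; have := cs n ns; rewrite cE//; case/andP: ns.
move=> ns; have <- : mkseq c n = mkseq c' n.
  by apply: mkseq_agree; apply: agree_le cc'; exact: leq_trans (leq_addr _ _).
apply: cc'; apply: leq_trans (leq_addl _ _).
exact: (@leq_bigmax _ (fun n : 'I_(size s).+1 => (code n).+1) (Ordinal (ns : n < (size s).+1)%N)).
Qed.

Lemma clopen_all (I : eqType) (r : seq I) (A : I -> set (nat -> bool)) :
  (forall i, clopen_pred (A i)) -> clopen_pred [set c | forall i, i \in r -> A i c].
Proof.
move=> cA; elim: r => [|i r IH] c; first by exists 0%N => c' _; split.
have [m mA] := cA i c; have [n nA] := IH c; exists (maxn m n) => c' cc'.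
have {}mA := mA c' (agree_le (leq_maxl _ _) cc').
have {}nA := nA c' (agree_le (leq_maxr _ _) cc').
split=> h j; rewrite inE => /orP[/eqP ->|jr].
- by apply/mA; apply: h; rewrite mem_head.
- by move: j jr; apply/nA => j jr; apply: h; rewrite inE jr orbT.
- by apply/mA; apply: h; rewrite mem_head.
- by move: j jr; apply/nA => j jr; apply: h; rewrite inE jr orbT.
Qed.

Section effros.
Variable R : realType.

(** As [U] is open, a point of the closed span in [U] can be replaced by a
    finite combination. *)
Lemma koethe_meets_open (A : set (seq nat)) (U : set (CR R)) : open U ->
  (koethe R A : set (CR R)) `&` U !=set0 <->
  exists r : seq (seq nat), (exists2 L : seq (R * seq nat),
    {subset map snd L <= r} & U (combination L)) /\ forall s, s \in r -> A s.
Proof.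
have [_ _ _ pn] := @CR_graded R.
move=> oU; split=> [[x [xA Ux]]|[r [[L Lr UL] rA]]].
  have /pn[n [e e0 eU]] : nbhs x U by exact: open_nbhs_nbhs.
  have [L AL xL] := (xA : closed_span A x) n e e0.
  exists (map snd L); split; last by move=> s /mapP[c cL ->]; exact: AL.
  exists L => //; apply: eU => /=.
  by rewrite -(gradedN (@CR_graded R)) opprB.
exists (combination L); split => //.
by apply: combination_closed_span => c cL; apply/rA/Lr/map_f.
Qed.

(** Meeting [U] is a countable union, over the finite sets of indices, of
    conditions on finitely many entries of [c]. *)
Lemma koethe_effros (U : set (CR R)) : open U -> bianalytic
  ((fun c => koethe R (diagonal_tree c)) @^-1`
    [set X : SF R | (X : set (CR R)) `&` U !=set0]).
Proof.
move=> oU.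
pose Q (r : seq (seq nat)) := exists2 L : seq (R * seq nat),
    {subset map snd L <= r} & U (combination L).
pose V i : set (nat -> bool) := if unpickle i is Some r then
  [set c | Q r /\ forall s : seq nat, s \in r -> diagonal_tree c s] else set0.
rewrite (_ : _ @^-1` _ = \bigcup_i V i); last first.
  apply/seteqP; split=> c /=; rewrite (koethe_meets_open _ oU).
    by move=> [r rP]; exists (pickle r) => //; rewrite /V pickleK.
  by move=> [i _]; rewrite /V; case: unpickle => // r rP; exists r.
apply: bianalytic_bigcup => i; apply: clopen_bianalytic; rewrite /V.
case: unpickle => [r c|c]; last by exists 0%N.
have [n nP] := @clopen_all _ r _ clopen_diagonal_tree c.
by exists n => c' /nP ncc; split=> -[Qr h]; split => //; apply/ncc.
Qed.

(** If [P] were Borel, then the set of the [c] whose diagonal tree is well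
    founded would be analytic, that is, the projection of a closed set with some
    code [d].  The branches of the diagonal tree at [d] are then the witnesses
    that [d] belongs to this set, so that this tree is well founded exactly when
    it has a branch. *)
Lemma koethe_dichotomy_not_borel (P : set (SF R)) :
  (forall A, tree A -> (forall k, A [:: k]) ->
    (forall b, ~ branch A b) -> P (koethe R A)) ->
  (forall A b, branch A b -> ~ P (koethe R A)) ->
  ~ SF_borel P.
Proof.
move=> Pwf Pill bP.
have [[F cF FP] _] := borel_preimage_bianalytic
  (f := fun c => koethe R (diagonal_tree c))
  (G := [set [set X : SF R | (X : set (CR R)) `&` U !=set0] | U in @open (CR R)])
  (fun S GS => let: ex_intro2 U oU e := GS in
    eq_ind _ (fun S => bianalytic (_ @^-1` S)) (koethe_effros oU) S e) bP.
pose ext (st : seq bool * seq nat) := exists c b,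
  [/\ F c b, mkseq c (size st.1) = st.1 & mkseq b (size st.2) = st.2].
pose d i := if unpickle i is Some st then `[< ext st >] else false.
have dP b : branch (diagonal_tree d) b <-> F d b.
  rewrite branch_diagonal_tree; split=> [bd|Fdb n _].
    apply: cF => n; have := bd n.+2 isT; rewrite {1}/d pickleK => /asboolP.
    move=> [c' [b' [Fcb]]]; rewrite /= !size_map !size_iota => cc bb.
    by exists c', b'; split => //; apply: (@agree_le _ _ n.+2);
      [rewrite leqW|apply: agree_mkseq|rewrite leqW|apply: agree_mkseq].
  rewrite {1}/d pickleK; apply/asboolP; exists d, b.
  by split => //=; rewrite size_map size_iota.
have [[b bd]|nb] := pselect (exists b, branch (diagonal_tree d) b).
  by apply: (Pill _ _ bd); apply/FP; exists b; exact/dP.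
apply: (nb); have /FP[b /dP bd] : P (koethe R (diagonal_tree d)).
  apply: Pwf; [exact: tree_diagonal_tree|exact: diagonal_tree1|].
  by move=> b bd; apply: nb; exists b.
by exists b.
Qed.

Lemma koetheE (A : set (seq nat)) (x : CR R) :
  (koethe R A : set (CR R)) x <-> closed_span A x.
Proof. by []. Qed.

Lemma REFL_notB_not_borel : ~ SF_borel (REFL_notB R).
Proof.
apply: koethe_dichotomy_not_borel => [A tA A1 wfA|A b bA [reflA _]].
  split; first exact: koethe_reflexive (koetheE A) tA wfA.
  exact: koethe_not_normable (koetheE A) A1.
by apply: (koethe_not_reflexive (koetheE A) bA); exact: reflA.
Qed.

Lemma SD_notB_not_borel : ~ SF_borel (SD_notB R).
Proof.
apply: koethe_dichotomy_not_borel => [A tA A1 wfA|A b bA [sepA _]].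
  split; first exact: koethe_separable_dual (koetheE A) tA wfA.
  exact: koethe_not_normable (koetheE A) A1.
by apply: (koethe_not_separable_dual (koetheE A) bA); exact: sepA.
Qed.

End effros.

Theorem corollary4p2 (R : realType) :
  (forall X : completeNormedModType R,
     (is_reflexive X <-> is_reflexive (countable_power X)) /\
     (has_separable_dual X <-> has_separable_dual (countable_power X))) /\
  ~ SF_borel (REFL_notB R) /\
  ~ SF_borel (SD_notB R).
Proof.
split; last by split; [exact: REFL_notB_not_borel|exact: SD_notB_not_borel].
move=> X; split; first exact: reflexive_countable_power_iff.
exact: separable_dual_countable_power_iff.
Qed.
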